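(* Let $G=(G_1,\dots,G_n)$ be a mean zero Gaussian vector with infinitely divisible squares, whose covariance matrix $\Gamma$ is strictly positive definite and irreducible and such that $\Gamma^{-1}$ is an $M$-matrix. Let $D_i=\sum_{k=1}^n(\Gamma^{-1})_{i,k}$ and $\mathcal D=\{(i,j): D_iD_j<0\}$. If $\mathcal D\neq\emptyset$ and $\alpha_0$ is a critical point of $G$, then $$\alpha_0\le \inf_{(i,j)\in\mathcal D}\Big(\frac{(\Gamma^{-1})_{i,j}}{2D_iD_j}\Big)^{1/2}.$$
   Context: A random vector $G$ has infinitely divisible squares if for every $m\in\mathbb N$, $G^2=(G_1^2,\dots,G_n^2)$ equals in law a sum of $m$ i.i.d. random vectors. For $\alpha\in\mathbb R$, $(G+\alpha\mathbf 1)^2=((G_1+\alpha)^2,\dots,(G_n+\alpha)^2)$. A real number $0<\alpha_0<\infty$ is a critical point of $G$ if $(G+\alpha\mathbf 1)^2$ is infinitely divisible for all $|\alpha|\le\alpha_0$ and not infinitely divisible for any $|\alpha|>\alpha_0$; if $(G+\alpha\mathbf 1)^2$ is infinitely divisible for all $\alpha$, $G$ has no critical point. A non-singular matrix $A$ is an $M$-matrix if all entries of $A^{-1}$ are non-negative and $A_{i,j}\le0$ for $i\ne j$. A symmetric matrix is irreducible if it is not a direct sum of square matrices. *)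

(* Defs.v *)
From HB Require Import structures.
From mathcomp Require Import all_boot all_order all_algebra.
From mathcomp Require Import all_classical all_reals all_analysis.
From mathcomp Require Import normal_distribution.

Set Implicit Arguments.
Unset Strict Implicit.
Unset Printing Implicit Defensive.

Import Order.TTheory GRing.Theory Num.Theory.
Local Open Scope classical_set_scope.
Local Open Scope ring_scope.

Definition rvec_measurable d (T : measurableType d) (R : realType) (n : nat)
  (X : 'I_n -> T -> R) : Prop := forall i, measurable_fun setT (X i).

(* Equality in law of two random vectors in R^n (possibly on different
   probability spaces): their joint laws agree on all measurable rectangles
   B_1 x ... x B_n (which generate the Borel sigma-algebra of R^n, so this
   is equality of the joint laws). *)
Definition law_eq d1 d2 (T1 : measurableType d1) (T2 : measurableType d2)
  (R : realType) (P1 : probability T1 R) (P2 : probability T2 R) (n : nat)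
  (X : 'I_n -> T1 -> R) (Y : 'I_n -> T2 -> R) : Prop :=
  forall B : 'I_n -> set R, (forall i, measurable (B i)) ->
    P1 [set w | forall i, B i (X i w)] = P2 [set w | forall i, B i (Y i w)].

Definition iid_rvecs d (T : measurableType d) (R : realType)
  (P : probability T R) (m n : nat) (Y : 'I_m -> 'I_n -> T -> R) : Prop :=
  (forall B : 'I_m -> 'I_n -> set R, (forall k i, measurable (B k i)) ->
     P [set w | forall k i, B k i (Y k i w)] =
     (\prod_(k < m) P [set w | forall i, B k i (Y k i w)])%E) /\
  (forall k l : 'I_m, law_eq P P (Y k) (Y l)).

Definition inf_divisible d (T : measurableType d) (R : realType)
  (P : probability T R) (n : nat) (X : 'I_n -> T -> R) : Prop :=
  forall m : nat, (0 < m)%N ->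
    exists (d' : measure_display) (T' : measurableType d')
           (P' : probability T' R) (Y : 'I_m -> 'I_n -> T' -> R),
      (forall k, rvec_measurable (Y k)) /\ iid_rvecs P' Y /\
      law_eq P P' X (fun i w => \sum_(k < m) Y k i w).

Definition shifted_sq d (T : measurableType d) (R : realType) (n : nat)
  (G : 'I_n -> T -> R) (alpha : R) : 'I_n -> T -> R :=
  fun i w => (G i w + alpha) ^+ 2.

Definition sq_rvec d (T : measurableType d) (R : realType) (n : nat)
  (G : 'I_n -> T -> R) : 'I_n -> T -> R :=
  fun i w => (G i w) ^+ 2.

(* G is a mean zero Gaussian vector with covariance matrix Gamma:
   G is measurable and every linear combination u.G is a centered normal
   random variable with variance u^T Gamma u (Dirac mass at 0 when this
   variance is 0). [normal_prob m s] is the normal law with mean m and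
   standard deviation s. *)
Definition centered_gaussian d (T : measurableType d) (R : realType)
  (P : probability T R) (n : nat) (G : 'I_n -> T -> R) (Gamma : 'M[R]_n) :
  Prop :=
  rvec_measurable G /\
  forall u : 'I_n -> R,
    let v := \sum_(i < n) \sum_(j < n) u i * u j * Gamma i j in
    forall A : set R, measurable A ->
      P [set w | A (\sum_(i < n) u i * G i w)] =
      (if 0 < v then normal_prob 0 (Num.sqrt v) A else \d_(0 : R) A).

Definition pos_def (R : realType) (n : nat) (A : 'M[R]_n) : Prop :=
  A^T = A /\
  forall x : 'cV[R]_n, x != 0 -> 0 < (x^T *m A *m x) ord0 ord0.

(* irreducible: not a direct sum of square matrices (after a simultaneous
   permutation of rows and columns), i.e. there is no nonempty proper set S
   of indices with A i j = 0 = A j i for i in S, j not in S. *)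
Definition irreducible_mx (R : realType) (n : nat) (A : 'M[R]_n) : Prop :=
  ~ exists S : {set 'I_n},
      [/\ S != finset.set0, S != [set: 'I_n]%SET &
          forall i j, i \in S -> j \notin S -> A i j = 0 /\ A j i = 0].

Definition M_matrix (R : realType) (n : nat) (A : 'M[R]_n) : Prop :=
  [/\ A \in unitmx,
      forall i j, 0 <= invmx A i j &
      forall i j, i != j -> A i j <= 0].

Definition critical_point d (T : measurableType d) (R : realType)
  (P : probability T R) (n : nat) (G : 'I_n -> T -> R) (alpha0 : R) : Prop :=
  [/\ 0 < alpha0,
      forall alpha : R, `|alpha| <= alpha0 -> inf_divisible P (shifted_sq G alpha) &
      forall alpha : R, alpha0 < `|alpha| -> ~ inf_divisible P (shifted_sq G alpha)].

Definition row_sum_inv (R : realType) (n : nat) (Gamma : 'M[R]_n) (i : 'I_n) : R :=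
  \sum_(k < n) invmx Gamma i k.

(* Main.v *)
Require Import Defs.
From HB Require Import structures.
From mathcomp Require Import all_boot all_order all_algebra.
From mathcomp Require Import all_classical all_reals all_analysis.
From mathcomp Require Import measurable_realfun normal_distribution.
From mathcomp Require Import ring lra.

(* If a vector Z >= 0 is infinitely divisible with Laplace transform phi, then phi = psi_m ^ m
   with psi_m the transform of some Y >= 0, and E[e^(-l.Y) (1 - e^(-Y_i)) (1 - e^(-Y_j))] >= 0;
   letting m -> oo, phi(l + e_i) phi(l + e_j) <= phi(l) phi(l + e_i + e_j).

   For Z = (G + alpha)^2, put A = Gamma^-1 and B = A + t. Reweighting the law of X = G + alpha by
   prod_k e^(- t X_k^2 / 2) yields, up to a constant, a Gaussian law of covariance M = B^-1 and
   mean mu = alpha M D, and the inequality above at l = t forces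
   0 <= M_ij^2 + 2 M_ij mu_i mu_j. As Gamma is irreducible, M_ij > 0, whence
   0 <= M_ij + 2 mu_i mu_j. Finally t^2 M_ij -> - A_ij and t mu_i -> alpha D_i as t -> oo, so
   0 <= - A_ij + 2 alpha^2 D_i D_j. Working with the point where M_ij > 0 before passing to the
   limit covers the case A_ij = 0 as well. *)

Set Implicit Arguments.
Unset Strict Implicit.
Unset Printing Implicit Defensive.

Import Order.TTheory GRing.Theory Num.Theory.
Import numFieldNormedType.Exports.
Local Open Scope classical_set_scope.
Local Open Scope ring_scope.

(** Two features of the definitions shape the argument. Equality in law and independence are given
    on rectangles only, and a Gaussian vector only through the laws of its linear combinations. So
    expectations are taken of products of one-variable functions, reached from indicators one factor
    at a time, and Gaussian integrals are read off the transforms E[W cos(th.X + c)], where the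
    phase c replaces complex exponentials; no density on R^n appears. The reweighting is done one
    coordinate at a time: a factor e^(- l X_k^2 / 2) is an average of cosines and acts on the
    covariance by a rank one correction, while the precision matrix just gains l at the entry (k, k)
    and the vector v = A mu stays fixed. After all coordinates there remain the linear equations B M
    = 1 and B mu = alpha D, which determine M and mu. The large weight t serves to expose A:
    divisibility constrains covariances, whereas the conclusion concerns an entry of the inverse,
    and the expansion of (A + t)^-1 in powers of 1/t has - A / t^2 as its first off-diagonal
    term. *)

(** * From indicators to bounded measurable functions *)

Definition unit_valued d (U : measurableType d) (R : realType) (f : U -> R) :=
  measurable_fun setT f /\ forall x, 0 <= f x <= 1.

(** Midpoints are all that the halving argument below consumes, and the bound [K] starts its
    geometric decay. *)
Definition midpoint_affine d (U : measurableType d) (R : realType)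
    (F : (U -> R) -> R) :=
  (forall f g, unit_valued f -> unit_valued g ->
    F (fun x => (f x + g x) / 2) = (F f + F g) / 2) /\
  exists K, forall f, unit_valued f -> `|F f| <= K.

Lemma unit_valued_indic d (U : measurableType d) (R : realType) (B : set U) :
  measurable B -> unit_valued (\1_B : U -> R).
Proof.
move=> mB; split; first exact: measurable_indic.
by move=> x; rewrite indicE ler0n lern1 leq_b1.
Qed.

(* Halving: f = (1_[f >= 1/2] + g) / 2 with g again unit valued, so the
   discrepancy of two such functionals is at most half of itself. *)
Lemma midpoint_affine_ext d (U : measurableType d) (R : realType)
    (F1 F2 : (U -> R) -> R) :
  midpoint_affine F1 -> midpoint_affine F2 ->
  (forall B, measurable B -> F1 \1_B = F2 \1_B) ->
  forall f, unit_valued f -> F1 f = F2 f.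
Proof.
move=> [A1 [K1 b1]] [A2 [K2 b2]] F12.
have step n f : unit_valued f -> `|F1 f - F2 f| <= (K1 + K2) / 2 ^+ n.
  elim: n f => [|n IH] f uf.
    rewrite expr0 divr1 (le_trans (ler_normB _ _))// lerD//; [exact: b1|exact: b2].
  have [mf f01] := uf.
  pose B := [set x | 2^-1 <= f x].
  have mB : measurable B.
    have -> : B = setT `&` f @^-1` `[2^-1, +oo[.
      by rewrite setTI; apply/seteqP; split=> x /=; rewrite in_itv/= andbT.
    exact: mf.
  pose g x := 2 * f x - \1_B x.
  have ug : unit_valued g.
    split.
      apply: measurable_funB; last exact: measurable_indic.
      exact: measurable_funM.
    move=> x; rewrite /g indicE; have /andP[f0 f1] := f01 x.
    case: (boolP (x \in B)) => [/set_mem|/negP xB] /=.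
      by rewrite /B/= => ?; lra.
    have : ~ (2^-1 <= f x) by move=> h; apply: xB; exact/mem_set.
    move=> /negP; rewrite -ltNge => ?; lra.
  have -> : f = (fun x => (\1_B x + g x) / 2).
    by apply/funext => x; rewrite /g; lra.
  have uB := unit_valued_indic R mB.
  rewrite A1// A2// F12//.
  have -> : (F2 \1_B + F1 g) / 2 - (F2 \1_B + F2 g) / 2 = (F1 g - F2 g) / 2 by lra.
  rewrite normrM (@ger0_norm _ 2^-1) ?invr_ge0// exprS invfM mulrCA mulrC.
  by rewrite ler_wpM2l ?invr_ge0// IH.
move=> f uf; apply/eqP; rewrite -subr_eq0 -normr_eq0 eq_le normr_ge0 andbT.
have K0 : 0 <= K1 + K2 by have := step 0%N f uf; rewrite expr0 divr1; apply: le_trans.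
apply/ler_addgt0Pl => e e0; rewrite addr0.
have [n] : exists n : nat, (K1 + K2) / e < n%:R.
  by exists (Num.bound ((K1 + K2) / e)); apply: archi_boundP; rewrite divr_ge0// ltW.
move=> ne; apply: le_trans (step n f uf) _.
rewrite ler_pdivrMr ?exprn_gt0// mulrC -ler_pdivrMr//.
apply: le_trans (ltW ne) _; rewrite -natrX ler_nat ltnW//; exact: ltn_expl.
Qed.

Definition upd (I : eqType) (V : Type) (f : I -> V) (i : I) (v : V) : I -> V :=
  fun j => if j == i then v else f j.

Lemma upd_self (I : eqType) V (f : I -> V) i : upd f i (f i) = f.
Proof. by apply/funext => j; rewrite /upd; case: eqP => // ->. Qed.

(** Rectangles only give the case where every slot holds an indicator. Slots are freed one at a
    time, each by the one-variable extension with the other slots frozen. *)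
Lemma midpoint_affine_family_ext d (U : measurableType d) (R : realType)
    (I : finType) (F1 F2 : (I -> U -> R) -> R) :
  (forall f i, (forall j, unit_valued (f j)) ->
     midpoint_affine (fun g => F1 (upd f i g)) /\
     midpoint_affine (fun g => F2 (upd f i g))) ->
  (forall B : I -> set U, (forall i, measurable (B i)) ->
     F1 (fun i => \1_(B i)) = F2 (fun i => \1_(B i))) ->
  forall f, (forall i, unit_valued (f i)) -> F1 f = F2 f.
Proof.
move=> aff ind.
(* [r] lists the slots that may hold an arbitrary function; those outside [r] hold indicators. *)
have main (r : seq I) f : (forall i, unit_valued (f i)) ->
    (forall i, i \notin r -> exists2 B, measurable B & f i = \1_B) -> F1 f = F2 f.
  elim: r f => [|k r IH] f uf indf.
    have /choice[B HB] i : exists B, measurable B /\ f i = \1_B.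
      by have [B mB ->] := indf i isT; exists B.
    have -> : f = fun i => \1_(B i) by apply/funext => i; have [_ ->] := HB i.
    by apply: ind => i; have [] := HB i.
  have [aff1 aff2] := aff f k uf.
  rewrite -(upd_self f k).
  apply: (midpoint_affine_ext aff1 aff2) => [B mB|]; last exact: uf.
  apply: IH => i; rewrite /upd; case: eqVneq => [_|ik].
  - exact: unit_valued_indic.
  - exact: uf.
  - by exists B.
  - by move=> ir; apply: indf; rewrite in_cons negb_or ik.
move=> f uf; apply: (main (enum I)) => // i.
by rewrite mem_enum.
Qed.

Section weighted_integral.
Context d (T : measurableType d) (R : realType) (mu : {measure set T -> \bar R}).

Lemma integrable_bounded_mul (W f : T -> R) (K : R) :
  mu.-integrable setT (EFin \o W) -> measurable_fun setT f ->
  (forall x, `|f x| <= K) ->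
  mu.-integrable setT (EFin \o (fun x => W x * f x)).
Proof.
move=> iW mf fK.
have mW : measurable_fun setT W by apply/measurable_EFinP; exact: measurable_int iW.
apply: (@le_integrable _ _ _ mu setT measurableT _ (EFin \o (fun x => K * W x))).
- by apply/measurable_EFinP; apply: measurable_funM.
- move=> x _ /=; rewrite lee_fin !normrM mulrC ler_wpM2r//.
  by rewrite (le_trans (fK x))// ler_norm.
- have := integrableZl measurableT K iW.
  by apply: eq_integrable => // x _; rewrite /= EFinM.
Qed.

Lemma midpoint_affine_integral d' (U : measurableType d') (W : T -> R) (X : T -> U) c :
  mu.-integrable setT (EFin \o W) -> (forall x, 0 <= W x) ->
  measurable_fun setT X ->
  midpoint_affine (fun g : U -> R => c * \int[mu]_x (W x * g (X x))).
Proof.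
move=> iW W0 mX.
have iWg g : unit_valued g -> mu.-integrable setT (EFin \o (fun x => W x * g (X x))).
  move=> [mg g01]; apply: (@integrable_bounded_mul _ _ 1) => //.
    exact: measurableT_comp.
  by move=> x; have /andP[? ?] := g01 (X x); rewrite ger0_norm.
split=> [f g uf ug|].
  rewrite -mulrDr -RintegralD//; [|exact: iWg..].
  rewrite -!mulrA; congr (c * _).
  rewrite -RintegralZr//; last first.
    have := integrableD measurableT (iWg _ uf) (iWg _ ug).
    by apply: eq_integrable => // x _; rewrite /= EFinD.
  by apply: eq_Rintegral => x _; lra.
exists (`|c| * \int[mu]_x W x) => g ug.
rewrite normrM ler_wpM2l//.
apply: le_trans (le_normr_Rintegral measurableT (iWg _ ug)) _.
apply: le_Rintegral => //.
  by apply: (integrable_norm (iWg _ ug)).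
move=> x _; have [_ /(_ (X x))/andP[? ?]] := ug.
by rewrite normrM !ger0_norm// ler_piMr.
Qed.

End weighted_integral.

(** A bounded [f] is an affine image of the unit valued (f + L) / (2 L), so linearity carries the
    equality over from unit valued functions and constants. Taking L = |K| + 1 keeps the denominator
    positive. *)
Lemma weighted_integral_ext d1 d2 d' (T1 : measurableType d1) (T2 : measurableType d2)
    (U : measurableType d') (R : realType)
    (mu1 : {measure set T1 -> \bar R}) (mu2 : {measure set T2 -> \bar R})
    (W1 : T1 -> R) (W2 : T2 -> R) (X1 : T1 -> U) (X2 : T2 -> U) (c K : R) :
  mu1.-integrable setT (EFin \o W1) -> (forall x, 0 <= W1 x) -> measurable_fun setT X1 ->
  mu2.-integrable setT (EFin \o W2) -> (forall x, 0 <= W2 x) -> measurable_fun setT X2 ->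
  (forall B, measurable B ->
     \int[mu1]_x (W1 x * \1_B (X1 x)) = c * \int[mu2]_x (W2 x * \1_B (X2 x))) ->
  forall f : U -> R, measurable_fun setT f -> (forall x, `|f x| <= K) ->
    \int[mu1]_x (W1 x * f (X1 x)) = c * \int[mu2]_x (W2 x * f (X2 x)).
Proof.
move=> iW1 W10 mX1 iW2 W20 mX2 ind.
have ext g : unit_valued g ->
    \int[mu1]_x (W1 x * g (X1 x)) = c * \int[mu2]_x (W2 x * g (X2 x)).
  move=> ug; rewrite -[LHS]mul1r; move: g ug.
  apply: midpoint_affine_ext; [exact: midpoint_affine_integral..|].
  by move=> B mB; rewrite mul1r ind.
move=> f mf fK.
pose L := `|K| + 1; have L0 : 0 < L by rewrite ltr_wpDl.
have fL x : - L <= f x <= L.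
  rewrite -ler_norml (le_trans (fK x))// (le_trans (ler_norm K))// /L lerDl//.
pose g x := (f x + L) / (2 * L).
have ug : unit_valued g.
  split; first by apply: measurable_funM => //; apply: measurable_funD.
  move=> x; have /andP[? ?] := fL x; rewrite /g; apply/andP; split.
    by rewrite divr_ge0//; lra.
  by rewrite ler_pdivrMr; lra.
have split_int d (T : measurableType d) (mu : {measure set T -> \bar R}) (W : T -> R) X :
    mu.-integrable setT (EFin \o W) -> measurable_fun setT X ->
    \int[mu]_x (W x * f (X x)) =
    (2 * L) * \int[mu]_x (W x * g (X x)) - L * \int[mu]_x (W x * 1).
  move=> iW mX.
  have i1 : mu.-integrable setT (EFin \o (fun x => W x * g (X x))).
    apply: (@integrable_bounded_mul _ _ _ _ _ _ 1) => //.
      by case: ug => mg _; exact: measurableT_comp.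
    by move=> x; have [_ /(_ (X x))/andP[? ?]] := ug; rewrite ger0_norm.
  have i2 : mu.-integrable setT (EFin \o (fun x => W x * 1)).
    by apply: (@integrable_bounded_mul _ _ _ _ _ (cst 1) 1) => // x; rewrite normr1.
  rewrite -!RintegralZl//.
  rewrite -RintegralB//.
  - by apply: eq_Rintegral => x _; rewrite /g; field; rewrite gt_eqF.
  - have := integrableZl measurableT (2 * L) i1.
    by apply: eq_integrable => // x _; rewrite /= EFinM.
  - have := integrableZl measurableT L i2.
    by apply: eq_integrable => // x _; rewrite /= EFinM.
rewrite (split_int _ _ mu1 W1 X1)// (split_int _ _ mu2 W2 X2)// ext//.
have := ext (cst 1); rewrite /= => ->; first by ring.
by split=> // x; rewrite lexx ler01.
Qed.

(** * Trigonometric integrals against normal laws *)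

Lemma norm_cos_le1 (R : realType) (x : R) : `|cos x| <= 1.
Proof. by rewrite ler_norml cos_geN1 cos_le1. Qed.

Lemma norm_sin_le1 (R : realType) (x : R) : `|sin x| <= 1.
Proof. by rewrite ler_norml sin_geN1 sin_le1. Qed.

Lemma continuous_cos_affine (R : realType) (u v : R) : continuous (fun y : R => cos (u * y + v)).
Proof.
move=> x; apply: continuous_comp; last exact: continuous_cos.
by apply: cvgD; [apply: cvgMl_tmp; exact: cvg_id|exact: cvg_cst].
Qed.

Lemma continuous_sin_affine (R : realType) (u v : R) : continuous (fun y : R => sin (u * y + v)).
Proof.
move=> x; apply: continuous_comp; last exact: continuous_sin.
by apply: cvgD; [apply: cvgMl_tmp; exact: cvg_id|exact: cvg_cst].
Qed.

Section normal_characteristic_function.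
Context (R : realType).
Local Notation mu := (@lebesgue_measure R).
Local Notation gam := (@normal_pdf R 0 1).

Lemma normal_pdf_tilt (m y : R) : normal_pdf m 1 y = expR (m * y - m ^+ 2 / 2) * gam y.
Proof.
rewrite !normal_pdfE ?oner_eq0// /normal_fun mulrCA -expRD; congr (_ * expR _).
by field.
Qed.

Lemma normal_pdf_affine (m s z : R) : 0 < s -> normal_pdf m s (m + s * z) * s = gam z.
Proof.
move=> s0; rewrite !normal_pdfE ?oner_eq0 ?gt_eqF// /normal_fun /normal_peak.
have -> : - (m + s * z - m) ^+ 2 / (s ^+ 2 *+ 2) = - (z - 0) ^+ 2 / (1 ^+ 2 *+ 2).
  by field; rewrite gt_eqF.
rewrite expr1n mul1r -mulrnAr sqrtrM ?sqr_ge0// sqrtr_sqr gtr0_norm// invfM.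
by rewrite mulrC !mulrA mulfV ?gt_eqF// mul1r.
Qed.

(** Substitution is applied to nonnegative integrands only: once to [g + K], once to the constant
    [K], and the two identities are subtracted. *)
Lemma normal_Rintegral_affine (m s K : R) (g : R -> R) :
  0 < s -> continuous g -> (forall x, `|g x| <= K) ->
  \int[mu]_y (normal_pdf m s y * g y) = \int[mu]_z (gam z * g (m + s * z)).
Proof.
move=> s0 cg gK.
have K0 : 0 <= K by apply: le_trans (gK 0).
have ge0case (f : R -> R) : continuous f -> (forall x, 0 <= f x) ->
    \int[mu]_y (normal_pdf m s y * f y) = \int[mu]_z (gam z * f (m + s * z)).
  move=> cf f0; rewrite /Rintegral; congr fine.
  pose F (x : R) := m + s * x.
  have dF x : is_derive x (1 : R) F s.
    rewrite /F; apply: is_derive_eq.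
    rewrite /GRing.scale/=; ring.
  have F' : (F^`())%classic = cst s by apply/funext => x; rewrite derive1E derive_val.
  rewrite (@increasing_ge0_integration_by_substitutionT R F (fun y => normal_pdf m s y * f y)).
  - apply: eq_integral => x _.
    by rewrite F' /= /F -(normal_pdf_affine m x s0) /= mulrAC.
  - by move=> x y xy; rewrite /F ltrD2l ltr_pM2l.
  - by rewrite F' => ?; exact: cvg_cst.
  - by rewrite F'; exact: is_cvg_cst.
  - by rewrite F'; exact: is_cvg_cst.
  - by move=> x; exact: ex_derive.
  - rewrite /F; apply/cvgrNyPle => A; exists ((A - m) / s); split; first exact: num_real.
    by move=> x xA; rewrite -lerBrDl [s * x]mulrC -ler_pdivlMr// ltW.
  - rewrite /F; apply/cvgryPge => A; exists ((A - m) / s); split; first exact: num_real.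
    by move=> x xA; rewrite -lerBlDl [s * x]mulrC -ler_pdivrMr// ltW.
  - move=> x; apply: (@continuousM R R _ f); last exact: cf.
    by apply: continuous_normal_pdf; rewrite gt_eqF.
  - by move=> x; rewrite mulr_ge0// normal_pdf_ge0.
have ipdf m' s' : mu.-integrable setT (EFin \o (@normal_pdf R m' s')).
  exact: integrable_normal_pdf.
have mg : measurable_fun setT g by exact: continuous_measurable_fun.
have mg' : measurable_fun setT (fun z => g (m + s * z)).
  by apply: (measurableT_comp mg); apply: measurable_funD => //; exact: mulrl_measurable.
have add m' s' (f : R -> R) : measurable_fun setT f -> (forall x, `|f x| <= K) ->
    \int[mu]_y (normal_pdf m' s' y * (f y + K)) =
    \int[mu]_y (normal_pdf m' s' y * f y) + \int[mu]_y (normal_pdf m' s' y * K).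
  move=> mf fK; rewrite -RintegralD//.
  - by apply: eq_Rintegral => y _; rewrite mulrDr.
  - exact: (integrable_bounded_mul (ipdf _ _) mf fK).
  - apply: (@integrable_bounded_mul _ _ _ mu _ (cst K) K) => // x.
    by rewrite /= ger0_norm.
have hK := ge0case (cst K) (fun=> cvg_cst _) (fun=> K0).
have := ge0case (fun y => g y + K).
rewrite (add _ _ _ mg gK) (add 0 1 _ mg' (fun z => gK (m + s * z))) [X in _ + X]hK.
move=> H; apply: (addIr _ (H _ _)).
- by move=> x; apply: cvgD; [exact: cg|exact: cvg_cst].
- by move=> x; rewrite -lerBlDr sub0r lerNnormlW.
Qed.

(** This is (e^(2 y) + e^(- 2 y)) times the standard density, written with recentred densities so
    that integrability is immediate. It dominates since |y| e^|y| <= e^(2 |y|), and serves both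
    differentiations under the integral. *)
Let dom (y : R) : R := expR 2 * (normal_pdf 2 1 y + normal_pdf (-2) 1 y).

Let dom_ge0 y : 0 <= dom y.
Proof. by rewrite mulr_ge0 ?expR_ge0// addr_ge0// normal_pdf_ge0. Qed.

Let integrable_dom : mu.-integrable setT (EFin \o dom).
Proof.
have := integrableD measurableT (@integrable_normal_pdf R 2 1) (@integrable_normal_pdf R (-2) 1).
move=> /(integrableZl measurableT (expR 2)).
by apply: eq_integrable => // x _; rewrite /= -EFinD -EFinM.
Qed.

Let dom_ub (m y : R) : `|m| <= 1 -> `|y| * expR (m * y) * gam y <= dom y.
Proof.
move=> m1; rewrite /dom (normal_pdf_tilt 2) (normal_pdf_tilt (-2)) -mulrDl mulrA ler_wpM2r ?normal_pdf_ge0//.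
have -> : expR 2 * (expR (2 * y - 2 ^+ 2 / 2) + expR (- 2 * y - (- 2) ^+ 2 / 2)) =
   expR (2 * y) + expR (- 2 * y).
  by rewrite mulrDr -!expRD; congr (expR _ + expR _); field.
apply: (@le_trans _ _ (expR (2 * `|y|))).
  rewrite (_ : 2 * `|y| = `|y| + `|y|) ?expRD; last by rewrite mulrDl mul1r.
  apply: ler_pM => //; rewrite ?expR_ge0//.
    by apply: le_trans (expR_ge1Dx _); rewrite lerDr.
  rewrite ler_expR (le_trans (ler_norm _))// normrM ler_piMl//.
have [y0|y0] := ger0P y; first by rewrite lerDl expR_ge0.
by rewrite mulrN -mulNr lerDr expR_ge0.
Qed.

(* Both sides are the derivative at m = 0 of the integral of sin(s y + f) e^(m y) against the
   normal density: e^(m y) merely recentres that density at m, up to e^(m^2 / 2). *)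
Lemma normal_sin_moment (s f : R) :
  \int[mu]_y (gam y * (y * sin (s * y + f))) = s * \int[mu]_y (gam y * cos (s * y + f)).
Proof.
pose k (m y : R) := gam y * (expR (m * y) * sin (s * y + f)).
pose A := \int[mu]_y (gam y * sin (s * y + f)).
pose B := \int[mu]_y (gam y * cos (s * y + f)).
have ig : mu.-integrable setT (EFin \o gam) by exact: integrable_normal_pdf.
have msin (u v : R) : measurable_fun setT (fun y => sin (u * y + v)).
  exact: (continuous_measurable_fun (@continuous_sin_affine R u v)).
have mcos (u v : R) : measurable_fun setT (fun y => cos (u * y + v)).
  exact: (continuous_measurable_fun (@continuous_cos_affine R u v)).
have sin1 := @norm_sin_le1 R.
have cos1 := @norm_cos_le1 R.
have kpdf m y : k m y = expR (m ^+ 2 / 2) * (normal_pdf m 1 y * sin (s * y + f)).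
  rewrite /k (normal_pdf_tilt m).
  have -> : expR (m * y) = expR (m ^+ 2 / 2) * expR (m * y - m ^+ 2 / 2).
    by rewrite -expRD; congr expR; ring.
  ring.
have kE m : \int[mu]_y k m y = expR (m ^+ 2 / 2) * (cos (s * m) * A + sin (s * m) * B).
  under eq_Rintegral do rewrite kpdf.
  rewrite RintegralZl//; last first.
    exact: (integrable_bounded_mul (@integrable_normal_pdf R m 1) (msin s f)
      (fun x => sin1 (s * x + f))).
  congr (_ * _).
  rewrite (@normal_Rintegral_affine m 1 1 (fun y => sin (s * y + f)))//; last first.
    exact: (@continuous_sin_affine R s f).
  rewrite /A /B -!RintegralZl//;
    [|exact: (integrable_bounded_mul ig (mcos s f) (fun x => cos1 (s * x + f)))
     |exact: (integrable_bounded_mul ig (msin s f) (fun x => sin1 (s * x + f)))].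
  rewrite -RintegralD//.
  - apply: eq_Rintegral => z _; rewrite mul1r mulrDr -addrA sinD; ring.
  - have := integrable_bounded_mul ig (msin s f) (fun x => sin1 (s * x + f)).
    move=> /(integrableZl measurableT (cos (s * m))).
    by apply: eq_integrable => // x _; rewrite /= -EFinM.
  - have := integrable_bounded_mul ig (mcos s f) (fun x => cos1 (s * x + f)).
    move=> /(integrableZl measurableT (sin (s * m))).
    by apply: eq_integrable => // x _; rewrite /= -EFinM.
have dk m y : is_derive m (1 : R) (k ^~ y) (gam y * (y * expR (m * y) * sin (s * y + f))).
  rewrite /k; apply: is_derive_eq.
  rewrite /GRing.scale /=; ring.

have d1 : (fun m => \int[mu]_y k m y)^`()%classic 0 = \int[mu]_y (gam y * (y * sin (s * y + f))).
  rewrite (@differentiation_under_integral _ _ _ mu k setT measurableT 0 (-1) 1 _ _ _ dom)//=.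
  - apply: eq_Rintegral => y _; rewrite partial1of2E.
    by have -> := @derive_val _ _ _ _ _ _ _ (dk 0 y); rewrite mul0r expR0 mulr1.
  - by rewrite in_itv/=; lra.
  - move=> m _.
    have := @integrable_bounded_mul _ _ _ mu _ _ 1 (@integrable_normal_pdf R m 1) (msin s f)
      (fun x => sin1 (s * x + f)).
    move=> /(integrableZl measurableT (expR (m ^+ 2 / 2))).
    by apply: eq_integrable => // y _; rewrite /= -EFinM kpdf.
  - move=> m y; rewrite in_itv/= => m1 _; rewrite partial1of2E.
    have -> := @derive_val _ _ _ _ _ _ _ (dk m y).
    apply: le_trans (@dom_ub m y _); last by rewrite ler_norml; lra.
    rewrite normrM ger0_norm ?normal_pdf_ge0// mulrC ler_wpM2r ?normal_pdf_ge0//.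
    by rewrite !normrM [`|expR _|]ger0_norm ?expR_ge0// ler_piMr// mulr_ge0// expR_ge0.
rewrite -d1 (_ : (fun m => _) = (fun m => expR (m ^+ 2 / 2) * (cos (s * m) * A + sin (s * m) * B))); last first.
  by apply/funext => m; exact: kE.
have D : is_derive (0 : R) (1 : R)
    (fun m => expR (m ^+ 2 / 2) * (cos (s * m) * A + sin (s * m) * B)) (s * B).
  apply: is_derive_eq.
  rewrite /GRing.scale /= !(mulr0, mul0r) expr0n /= mul0r expR0 cos0 sin0; ring.
by rewrite derive1E (@derive_val _ _ _ _ _ _ _ D).
Qed.

(** By the sine moment, the integral h(s) solves h' = - s h, so h(s) e^(s^2 / 2) is constant, equal
    to its value cos f at s = 0. *)
Lemma normal_cos_Rintegral (s f : R) :
  \int[mu]_y (gam y * cos (s * y + f)) = expR (- s ^+ 2 / 2) * cos f.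
Proof.
pose h (s : R) := \int[mu]_y (gam y * cos (s * y + f)).
pose k (s y : R) := gam y * cos (s * y + f).
have ig : mu.-integrable setT (EFin \o gam) by exact: integrable_normal_pdf.
have mcos (u v : R) : measurable_fun setT (fun y => cos (u * y + v)).
  exact: (continuous_measurable_fun (@continuous_cos_affine R u v)).
have cos1 := @norm_cos_le1 R.
have sin1 := @norm_sin_le1 R.
have dk u y : is_derive u (1 : R) (k ^~ y) (- (gam y * (y * sin (u * y + f)))).
  rewrite /k; apply: is_derive_eq.
  rewrite /GRing.scale /=; ring.
have intk u : mu.-integrable setT (EFin \o k u).
  exact: (integrable_bounded_mul ig (mcos u f) (fun x => cos1 (u * x + f))).
have kub u y : `|partial1of2 k u y| <= dom y.
  rewrite partial1of2E; have -> := @derive_val _ _ _ _ _ _ _ (dk u y).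
  apply: le_trans (@dom_ub 0 y _); last by rewrite normr0.
  rewrite normrN normrM ger0_norm ?normal_pdf_ge0// mulrC ler_wpM2r ?normal_pdf_ge0//.
  by rewrite normrM mul0r expR0 mulr1 ler_piMr.
have dh u : is_derive u (1 : R) h (- (u * h u)).
  (* Any neighbourhood of [u] would do, as the bound [kub] is uniform in [u]. *)
  have Iu : u \in `](u - 1), (u + 1)[ by rewrite in_itv/=; lra.
  apply: DeriveDef.
    apply: (@derivable_under_integral _ _ _ mu k setT measurableT u (u - 1) (u + 1) Iu _ _ dom) => //.
  rewrite -derive1E.
  rewrite (@differentiation_under_integral _ _ _ mu k setT measurableT u (u - 1) (u + 1) Iu _ _ dom)//.
  rewrite /h -normal_sin_moment -mulN1r -RintegralZl//.
    apply: eq_Rintegral => y _; rewrite partial1of2E.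
    by have -> := @derive_val _ _ _ _ _ _ _ (dk u y); rewrite mulN1r.
  have H : mu.-integrable setT (EFin \o (fun y => partial1of2 k u y)).
    apply: (le_integrable measurableT _ _ integrable_dom) => /=.
      apply/measurable_EFinP.
      rewrite (_ : (fun y => _) = (fun y => - (gam y * (y * sin (u * y + f))))); last first.
        by apply/funext => y; rewrite partial1of2E; have -> := @derive_val _ _ _ _ _ _ _ (dk u y).
      apply: measurableT_comp => //; apply: measurable_funM; first exact: measurable_normal_pdf.
      apply: measurable_funM => //.
      exact: (continuous_measurable_fun (@continuous_sin_affine R u f)).
    by move=> y _; rewrite lee_fin [leRHS]ger0_norm.
  have := integrableZl measurableT (-1) H.
  apply: eq_integrable => // y _; rewrite /= -EFinM partial1of2E.
  by have -> := @derive_val _ _ _ _ _ _ _ (dk u y); rewrite mulN1r opprK.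
have D u : is_derive u (1 : R) (fun u => h u * expR (u ^+ 2 / 2)) 0.
  apply: is_derive_eq.
  by rewrite /GRing.scale /=; field; rewrite ?pnatr_eq0.
have := @is_derive_0_is_cst R _ s 0 D.
rewrite /= expr0n/= mul0r expR0 mulr1 => hs.
have -> : \int[mu]_y (gam y * cos (s * y + f)) = h 0 * expR (- s ^+ 2 / 2).
  by rewrite -hs -mulrA -expRD mulNr subrr expR0 mulr1.
rewrite mulrC; congr (_ * _); rewrite /h.
under eq_Rintegral do rewrite mul0r add0r.
rewrite RintegralZr//.
by rewrite /Rintegral integral_normal_pdf mul1r.
Qed.

Lemma normal_prob_Rintegral (m s K : R) (g : R -> R) :
  measurable_fun setT g -> (forall x, `|g x| <= K) ->
  \int[normal_prob m s]_y g y = \int[mu]_y (normal_pdf m s y * g y).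
Proof.
move=> mg gK.
rewrite -[RHS]mul1r -(@weighted_integral_ext _ _ _ _ _ _ R (normal_prob m s) mu (cst 1)
  (normal_pdf m s) id id 1 K)//=.
- by apply: eq_Rintegral => y _; rewrite mul1r.
- exact: (finite_measure_integrable_cst (normal_prob m s) 1).
- exact: integrable_normal_pdf.
- by move=> x; exact: normal_pdf_ge0.
- move=> B mB; rewrite mul1r.
  under eq_Rintegral do rewrite mul1r.
  rewrite /Rintegral integral_indic// setIT /normal_prob; congr fine.
  rewrite [LHS]integral_mkcond; apply: eq_integral => x _.
  rewrite patchE indicE; case: ifP => _; rewrite ?mulr1 ?mulr0//.
Qed.

Lemma normal_prob_cos (m s u f : R) : 0 < s ->
  \int[normal_prob m s]_y cos (u * y + f) = expR (- (u * s) ^+ 2 / 2) * cos (u * m + f).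
Proof.
move=> s0.
have ccos := @continuous_cos_affine R u f.
have cos1 := @norm_cos_le1 R.
rewrite (@normal_prob_Rintegral m s 1)//; last exact: continuous_measurable_fun.
rewrite (@normal_Rintegral_affine m s 1 (fun y => cos (u * y + f)))//.
rewrite -normal_cos_Rintegral; apply: eq_Rintegral => z _.
by congr (_ * cos _); ring.
Qed.

End normal_characteristic_function.

Lemma measurable_exp_cos (R : realType) (a b e f : R) : measurable_fun setT
  (fun z : R => expR (- (a * z ^+ 2) / 2 - b * z) * cos (e * z + f)).
Proof.
apply: measurable_funM; last exact: (continuous_measurable_fun (@continuous_cos_affine R e f)).
apply: measurableT_comp => //.
apply: continuous_measurable_fun => x; apply: cvgB; last first.
  by apply: cvgMl_tmp; exact: cvg_id.
apply: cvgMr_tmp; apply: cvgN; apply: cvgMl_tmp; exact: sqr_continuous.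
Qed.

Lemma norm_exp_cos_le (R : realType) (a b e f z : R) : 0 < a ->
  `|expR (- (a * z ^+ 2) / 2 - b * z) * cos (e * z + f)| <= expR (b ^+ 2 / (2 * a)).
Proof.
move=> a0; rewrite normrM ger0_norm ?expR_ge0//.
apply: (@le_trans _ _ (expR (- (a * z ^+ 2) / 2 - b * z))).
  by rewrite ler_piMr ?expR_ge0// norm_cos_le1.
rewrite ler_expR -subr_ge0.
have -> : b ^+ 2 / (2 * a) - (- (a * z ^+ 2) / 2 - b * z) = (a * z + b) ^+ 2 / (2 * a).
  by field; rewrite gt_eqF.
by rewrite divr_ge0 ?sqr_ge0// mulr_ge0// ltW.
Qed.

(** Completing the square: the exponential times the standard density is a multiple of the normal
    density with mean - b / (1 + a) and variance 1 / (1 + a). *)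
Lemma normal_exp_cos (R : realType) (a b e f : R) : 0 < a ->
  \int[normal_prob 0 1]_z (expR (- (a * z ^+ 2) / 2 - b * z) * cos (e * z + f)) =
  (Num.sqrt (1 + a))^-1 * expR ((b ^+ 2 - e ^+ 2) / (2 * (1 + a))) *
    cos (f - e * b / (1 + a)).
Proof.
move=> a0.
have q0 : 0 < 1 + a by rewrite addr_gt0.
have qn0 : 1 + a != 0 by rewrite gt_eqF.
pose s := (Num.sqrt (1 + a))^-1.
have s0 : 0 < s by rewrite invr_gt0 sqrtr_gt0.
have s2 : s ^+ 2 = (1 + a)^-1 by rewrite exprVn sqr_sqrtr// ltW.
pose m := - b / (1 + a).
have pdfE z : normal_pdf 0 1 z * expR (- (a * z ^+ 2) / 2 - b * z) =
    s * expR (b ^+ 2 / (2 * (1 + a))) * normal_pdf m s z.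
  rewrite -(normal_pdf_affine 0 z s0) [in LHS]normal_pdfE ?gt_eqF//.
  rewrite [in RHS]normal_pdfE ?gt_eqF// /normal_fun -[s ^+ 2 *+ 2]mulr_natr s2.
  rewrite -![_ * s]mulrC -!mulrA; congr (_ * _).
  rewrite [RHS]mulrCA; congr (_ * _); rewrite -!expRD; congr expR.
  rewrite /m.
  have -> : - (0 + s * z - 0) ^+ 2 / ((1 + a)^-1 * 2) = - z ^+ 2 / 2.
    by rewrite add0r subr0 exprMn s2; field.
  by field.
rewrite (@normal_prob_Rintegral _ 0 1 (expR (b ^+ 2 / (2 * a)))); last 2 first.
- exact: measurable_exp_cos.
- by move=> z; exact: norm_exp_cos_le.
under eq_Rintegral do rewrite mulrA pdfE -[_ * normal_pdf m s _ * _]mulrA.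
rewrite RintegralZl//; last first.
  exact: (integrable_bounded_mul (@integrable_normal_pdf R m s) (continuous_measurable_fun (@continuous_cos_affine R e f))
    (fun x => norm_cos_le1 (e * x + f))).
rewrite -(@normal_prob_Rintegral R m s 1)//; last 2 first.
- exact: (continuous_measurable_fun (@continuous_cos_affine R e f)).
- by move=> x; exact: norm_cos_le1.
rewrite normal_prob_cos// !mulrA -[s * _ * _]mulrA -expRD; congr (_ * expR _ * cos _).
  by rewrite exprMn s2; field.
by rewrite /m; ring.
Qed.

(** * Effect of a Gaussian weight on the transform of a Gaussian vector *)

Lemma Rintegral_Fubini d1 d2 (T1 : measurableType d1) (T2 : measurableType d2) (R : realType)
    (P : probability T1 R) (Q : probability T2 R) (f : T1 * T2 -> R) (K : R) :
  measurable_fun setT f -> (forall x, `|f x| <= K) ->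
  \int[P]_x \int[Q]_y f (x, y) = \int[Q]_y \int[P]_x f (x, y).
Proof.
move=> mf fK.
have i1 x : Q.-integrable setT (EFin \o (fun y => f (x, y))).
  have := @integrable_bounded_mul _ _ _ Q (cst 1) (fun y => f (x, y)) K
    (finite_measure_integrable_cst Q 1 measurableT).
  rewrite /= => H; apply: eq_integrable (H _ _) => //.
  - by move=> y _; rewrite /= mul1r.
  - by apply: measurableT_comp => //; exact: pair1_measurable.
have i2 y : P.-integrable setT (EFin \o (fun x => f (x, y))).
  have := @integrable_bounded_mul _ _ _ P (cst 1) (fun x => f (x, y)) K
    (finite_measure_integrable_cst P 1 measurableT).
  rewrite /= => H; apply: eq_integrable (H _ _) => //.
  - by move=> x _; rewrite /= mul1r.
  - by apply: measurableT_comp => //; exact: pair2_measurable.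
have i12 : (P \x Q)%E.-integrable setT (EFin \o f).
  apply: (@le_integrable _ _ _ _ _ measurableT _ (EFin \o cst K)).
  - exact/measurable_EFinP.
  - by move=> x _; rewrite /= lee_fin (le_trans (fK x))// ler_norm.
  - exact: (finite_measure_integrable_cst (product_subprobability
      ((P : subprobability T1 R), (Q : subprobability T2 R))) K measurableT).
have := Fubini i12; rewrite /= => F.
rewrite /Rintegral; congr fine.
under eq_integral => x _.
  rewrite fineK; last by exact: integrable_fin_num (i1 x).
  over.
under [in RHS]eq_integral => x _.
  rewrite fineK; last by exact: integrable_fin_num (i2 x).
  over.
exact: F.
Qed.

Section gaussian_transform.
Context d (T : measurableType d) (R : realType) (P : probability T R) (n : nat).
Variable X : 'I_n -> T -> R.
Hypothesis mX : forall i, measurable_fun setT (X i).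

(* The law of X weighted by W is C times the normal law with covariance M and mean mu. *)
Definition gaussian_transform (W : T -> R) (C : R) (M : 'M[R]_n) (mu : 'cV[R]_n) :=
  forall (th : 'cV[R]_n) (c : R),
    \int[P]_w (W w * cos (\sum_k th k ord0 * X k w + c)) =
    C * expR (- (th^T *m M *m th) ord0 ord0 / 2) * cos ((th^T *m mu) ord0 ord0 + c).

Local Notation e_ k := (delta_mx k ord0 : 'cV[R]_n).

Lemma tr_shift (th : 'cV[R]_n) (k : 'I_n) (s : R) :
  (th + s *: e_ k)^T = th^T + s *: delta_mx ord0 k.
Proof. by rewrite linearD linearZ /= trmx_delta. Qed.

Lemma quad_shift (M : 'M[R]_n) (th : 'cV[R]_n) (k : 'I_n) (s : R) : M^T = M ->
  ((th + s *: e_ k)^T *m M *m (th + s *: e_ k)) ord0 ord0 =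
  (th^T *m M *m th) ord0 ord0 + 2 * s * (M *m th) k ord0 + s ^+ 2 * M k k.
Proof.
move=> sM.
have E1 : ((e_ k)^T *m M *m th) ord0 ord0 = (M *m th) k ord0.
  by rewrite -mulmxA trmx_delta -rowE mxE.
have E2 : (th^T *m M *m e_ k) ord0 ord0 = (M *m th) k ord0.
  by rewrite -E1 -[in LHS](trmxK (th^T *m M *m e_ k)) mxE !trmx_mul trmxK sM mulmxA.
have E3 : ((e_ k)^T *m M *m e_ k) ord0 ord0 = M k k.
  by rewrite trmx_delta -mulmxA -rowE -colE !mxE.
rewrite tr_shift !mulmxDl !mulmxDr -!scalemxAl -!scalemxAr.
move: E1 E2 E3; rewrite trmx_delta !mxE => E1 E2 E3.
rewrite E1 E2 E3; ring.
Qed.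

(* e^(- l x^2 / 2) is the average of cos(sqrt l x z) over a standard normal z, so that by Fubini
   the new transform is an average of the old one over th + sqrt l z e_k. *)
Lemma gaussian_transform_update (W : T -> R) (C : R) (M : 'M[R]_n) (mu : 'cV[R]_n)
    (k : 'I_n) (l : R) :
  measurable_fun setT W -> (forall w, 0 <= W w <= 1) ->
  M^T = M -> 0 < M k k -> 0 < l ->
  gaussian_transform W C M mu ->
  let q := 1 + l * M k k in
  gaussian_transform (fun w => W w * expR (- (l * X k w ^+ 2) / 2))
    (C * ((Num.sqrt q)^-1 * expR (- (l * mu k ord0 ^+ 2) / (2 * q))))
    (M - (l / q) *: (M *m e_ k *m (e_ k)^T *m M))
    (mu - (l * mu k ord0 / q) *: (M *m e_ k)).
Proof.
move=> mW W01 sM Mk l0 HW q th c.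
have a0 : 0 < l * M k k by rewrite mulr_gt0.
have qn0 : q != 0 by rewrite gt_eqF// /q addr_gt0.
pose s := Num.sqrt l.
have s2 : s ^+ 2 = l by rewrite sqr_sqrtr// ltW.
pose S w := \sum_k th k ord0 * X k w.
have mS : measurable_fun setT S by apply: measurable_sum => i; exact: measurable_funM.
have -> : \int[P]_w (W w * expR (- (l * X k w ^+ 2) / 2) * cos (S w + c)) =
    \int[P]_w \int[normal_prob 0 1]_z (W w * cos (s * X k w * z + (S w + c))).
  apply: eq_Rintegral => w _.
  rewrite RintegralZl//; last first.
    have mcos := continuous_measurable_fun (@continuous_cos_affine R (s * X k w) (S w + c)).
    have := integrable_bounded_mul (finite_measure_integrable_cst (normal_prob 0 1) 1 measurableT)
      mcos (fun z => norm_cos_le1 (s * X k w * z + (S w + c))).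
    by apply: eq_integrable => // z _; rewrite /= mul1r.
  rewrite normal_prob_cos// mulr0 add0r mulr1 exprMn s2 mulrA.
  by congr (_ * expR _ * _); rewrite mulNr.
rewrite (@Rintegral_Fubini _ _ _ _ R P (normal_prob 0 1)
  (fun x => W x.1 * cos (s * X k x.1 * x.2 + (S x.1 + c))) 1); first last.
- move=> x; rewrite normrM -[leRHS]mulr1 ler_pM// ?norm_cos_le1//.
  by have /andP[? ?] := W01 x.1; rewrite ger0_norm.
- apply: measurable_funM; first exact: measurableT_comp.
  apply: (measurableT_comp (continuous_measurable_fun (@continuous_cos R))).
  apply: measurable_funD.
    apply: measurable_funM => //; apply: measurable_funM => //.
    exact: (measurableT_comp (mX k)).
  by apply: measurable_funD => //; exact: (measurableT_comp mS).
pose m := (M *m th) k ord0.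
have inner z : \int[P]_w (W w * cos (s * X k w * z + (S w + c))) =
    C * expR (- (th^T *m M *m th) ord0 ord0 / 2) *
    (expR (- (l * M k k * z ^+ 2) / 2 - s * m * z) *
     cos (s * mu k ord0 * z + ((th^T *m mu) ord0 ord0 + c))).
  have := HW (th + (s * z) *: e_ k) c.
  rewrite quad_shift// -/m.
  have -> : ((th + (s * z) *: e_ k)^T *m mu) ord0 ord0 = (th^T *m mu) ord0 ord0 + s * z * mu k ord0.
    rewrite tr_shift mulmxDl -scalemxAl -rowE.
    by rewrite !mxE.
  have -> : - ((th^T *m M *m th) ord0 ord0 + 2 * (s * z) * m + (s * z) ^+ 2 * M k k) / 2 =
    - (th^T *m M *m th) ord0 ord0 / 2 + (- (l * M k k * z ^+ 2) / 2 - s * m * z).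
    by rewrite exprMn s2; field.
  rewrite expRD => H; transitivity (\int[P]_w (W w *
     cos (\sum_k0 (th + (s * z) *: e_ k) k0 ord0 * X k0 w + c))).
    apply: eq_Rintegral => w _; congr (_ * cos _).
    rewrite addrA; congr (_ + _).
    under [in RHS]eq_bigr do rewrite !mxE mulrDl.
    rewrite big_split /= addrC; congr (_ + _).
    rewrite (bigD1 k)//= big1 => [|i /negbTE ik]; last by rewrite ik mulr0 mul0r.
    by rewrite !eqxx mulr1 addr0; ring.
  rewrite H -!mulrA; congr (_ * (_ * (_ * cos _))); ring.
under eq_Rintegral => z _ do rewrite /= inner.
rewrite RintegralZl//; last first.
  have := @integrable_bounded_mul _ _ _ (normal_prob 0 1) (cst 1) _ _
    (finite_measure_integrable_cst (normal_prob 0 1) 1 measurableT)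
    (measurable_exp_cos (l * M k k) (s * m) (s * mu k ord0) ((th^T *m mu) ord0 ord0 + c))
    (fun z => norm_exp_cos_le _ _ _ z a0).
  by apply: eq_integrable => // z _; rewrite /= mul1r.
rewrite normal_exp_cos// -/q.
have -> : (th^T *m (M - (l / q) *: (M *m e_ k *m (e_ k)^T *m M)) *m th) ord0 ord0 =
    (th^T *m M *m th) ord0 ord0 - l / q * m ^+ 2.
  have E1 : ((e_ k)^T *m M *m th) ord0 ord0 = m.
    by rewrite -mulmxA trmx_delta -rowE mxE.
  have E2 : (th^T *m M *m e_ k) ord0 ord0 = m.
    by rewrite -E1 -[in LHS](trmxK (th^T *m M *m e_ k)) mxE !trmx_mul trmxK sM mulmxA.
  rewrite mulmxBr mulmxBl -scalemxAr -scalemxAl.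
  have -> : th^T *m (M *m e_ k *m (e_ k)^T *m M) *m th =
     (th^T *m M *m e_ k) *m ((e_ k)^T *m M *m th) by rewrite !mulmxA.
  move: E1 E2; move: (th^T *m M *m e_ k) ((e_ k)^T *m M *m th) => U V VE UE.
  rewrite [LHS]mxE; congr (_ + _); rewrite !mxE big_ord_recl big_ord0.
  by rewrite VE UE addr0 expr2 mulrA.
have -> : (th^T *m (mu - (l * mu k ord0 / q) *: (M *m e_ k))) ord0 ord0 =
    (th^T *m mu) ord0 ord0 - l * mu k ord0 / q * m.
  have E2 : (th^T *m M *m e_ k) ord0 ord0 = m.
    have E1 : ((e_ k)^T *m M *m th) ord0 ord0 = m.
      by rewrite -mulmxA trmx_delta -rowE mxE.
    by rewrite -E1 -[in LHS](trmxK (th^T *m M *m e_ k)) mxE !trmx_mul trmxK sM mulmxA.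
  rewrite mulmxBr -scalemxAr mulmxA.
  by rewrite [LHS]mxE; congr (_ + _); rewrite mxE [in LHS]mxE E2.
set Q0 := (th^T *m M *m th) ord0 ord0; set u := mu k ord0.
set t := (th^T *m mu) ord0 ord0.
have -> : t + c - s * u * (s * m) / q = t - l * u / q * m + c.
  by rewrite -[in RHS]s2; field.
have Eexp : expR (- Q0 / 2) * expR (((s * m) ^+ 2 - (s * u) ^+ 2) / (2 * q)) =
    expR (- (l * u ^+ 2) / (2 * q)) * expR (- (Q0 - l / q * m ^+ 2) / 2).
  by rewrite -!expRD; congr expR; rewrite !exprMn s2; field.
transitivity (C * (Num.sqrt q)^-1 * (expR (- Q0 / 2) *
  expR (((s * m) ^+ 2 - (s * u) ^+ 2) / (2 * q))) * cos (t - l * u / q * m + c)).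
  ring.
by rewrite Eexp; ring.
Qed.

End gaussian_transform.

(** * Positive definite matrices and rank one updates *)

Section pos_def_inverse.
Context (R : realType) (n : nat).
Implicit Types A M : 'M[R]_n.
Local Notation e_ k := (delta_mx k ord0 : 'cV[R]_n).

Lemma pos_def_inverse_sym A M : pos_def A -> A *m M = 1%:M -> M^T = M.
Proof.
move=> [sA _] AM; rewrite -[RHS]mul1mx -[1%:M](trmx1) -AM trmx_mul sA.
by rewrite -mulmxA AM mulmx1.
Qed.

Lemma pos_def_inverse A M : pos_def A -> A *m M = 1%:M -> pos_def M.
Proof.
move=> pA AM; have sM := pos_def_inverse_sym pA AM; split=> // x x0.
have MA := mulmx1C AM.
have -> : x^T *m M *m x = (M *m x)^T *m A *m (M *m x).
  by rewrite trmx_mul sM -!mulmxA (mulmxA A M x) AM mul1mx.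
apply: (proj2 pA); apply: contra_neq x0 => Mx.
by rewrite -[x]mul1mx -AM -mulmxA Mx mulmx0.
Qed.

Lemma pos_def_diag A k : pos_def A -> 0 < A k k.
Proof.
move=> [_ /(_ (e_ k))]; rewrite trmx_delta -rowE -colE !mxE; apply.
by apply/eqP => /matrixP/(_ k ord0); rewrite !mxE !eqxx => /eqP; rewrite oner_eq0.
Qed.

Lemma pos_def_add_diag A k (l : R) : 0 <= l -> pos_def A ->
  pos_def (A + l *: (e_ k *m (e_ k)^T)).
Proof.
move=> l0 [sA pA]; split.
  by rewrite linearD linearZ /= sA trmx_mul trmxK.
move=> x x0.
have -> : x^T *m (A + l *: (e_ k *m (e_ k)^T)) *m x =
    x^T *m A *m x + l *: (((e_ k)^T *m x)^T *m ((e_ k)^T *m x)).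
  by rewrite mulmxDr mulmxDl -scalemxAr -scalemxAl trmx_mul trmxK !mulmxA.
rewrite mxE ltr_wpDr ?pA// mxE mulr_ge0//.
by rewrite mxE big_ord_recl big_ord0 addr0 mxE -expr2 sqr_ge0.
Qed.

Lemma rank1_entry (M : 'M[R]_n) i j k :
  (M *m e_ k *m (e_ k)^T *m M) i j = M i k * M k j.
Proof.
rewrite trmx_delta -mulmxA -rowE -colE mxE big_ord_recl big_ord0 addr0.
by rewrite !mxE.
Qed.

(** Identifies the correction terms of [gaussian_transform_update]: the new covariance inverts A',
    and the new mean solves the same system with A' in place of A and an unchanged right-hand side
    [v]. *)
Lemma Sherman_Morrison A M (v mu : 'cV[R]_n) k (l : R) :
  A *m M = 1%:M -> A *m mu = v -> 1 + l * M k k != 0 ->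
  let A' := A + l *: (e_ k *m (e_ k)^T) in
  A' *m (M - (l / (1 + l * M k k)) *: (M *m e_ k *m (e_ k)^T *m M)) = 1%:M /\
  A' *m (mu - (l * mu k ord0 / (1 + l * M k k)) *: (M *m e_ k)) = v.
Proof.
set q := 1 + _ => AM Amu q0 A'.
have kk : (e_ k)^T *m M *m e_ k = (M k k)%:M.
  by apply/matrixP => i j; rewrite !ord1 trmx_delta -mulmxA -rowE -colE !mxE eqxx mulr1n.
have kmu : (e_ k)^T *m mu = (mu k ord0)%:M.
  by apply/matrixP => i j; rewrite !ord1 trmx_delta -rowE !mxE eqxx mulr1n.
have A'M : A' *m (M *m e_ k) = q *: e_ k.
  rewrite mulmxDl mulmxA AM mul1mx -scalemxAl -!mulmxA (mulmxA _ M) kk.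
  by rewrite mul_mx_scalar scalerA scalerDl scale1r.
split.
  have -> : A' *m (M - (l / q) *: (M *m e_ k *m (e_ k)^T *m M)) =
      A' *m M - (l / q) *: (A' *m (M *m e_ k) *m ((e_ k)^T *m M)).
    by rewrite mulmxBr -scalemxAr !mulmxA.
  rewrite A'M -scalemxAl scalerA mulfVK//.
  by rewrite mulmxDl AM -scalemxAl -mulmxA addrK.
rewrite mulmxBr -scalemxAr A'M scalerA mulfVK//.
by rewrite mulmxDl Amu -scalemxAl -mulmxA kmu mul_mx_scalar scalerA addrK.
Qed.

End pos_def_inverse.

(** * Reweighted Gaussian laws and their masses *)

Section gaussian_state.
Context d (T : measurableType d) (R : realType) (P : probability T R) (n : nat).
Variable X : 'I_n -> T -> R.
Hypothesis mX : forall i, measurable_fun setT (X i).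
Local Notation e_ k := (delta_mx k ord0 : 'cV[R]_n).

Definition sq_weight (l : R) (k : 'I_n) (w : T) : R := expR (- (l * X k w ^+ 2) / 2).

Lemma sq_weight01 l k w : 0 <= l -> 0 <= sq_weight l k w <= 1.
Proof.
move=> l0; rewrite expR_ge0 -expR0 ler_expR mulNr oppr_le0.
by rewrite divr_ge0// mulr_ge0// sqr_ge0.
Qed.

Lemma measurable_sq_weight l k : measurable_fun setT (sq_weight l k).
Proof.
apply: measurableT_comp => //; apply: measurable_funM => //.
apply: measurableT_comp => //; apply: measurable_funM => //.
exact: measurable_funX.
Qed.

(** Covariance and precision matrix are carried together: transforms and masses are explicit in [M]
    and [mu], whereas the effect of many weights is explicit only in [A] and [v]. *)
Definition gaussian_state (W : T -> R) (C : R) (M : 'M[R]_n) (mu : 'cV[R]_n)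
    (A : 'M[R]_n) (v : 'cV[R]_n) :=
  [/\ measurable_fun setT W, (forall w, 0 <= W w <= 1),
      gaussian_transform P X W C M mu & 
      [/\ 0 < C, pos_def A, A *m M = 1%:M & A *m mu = v]].

(** The expectation of e^(- l x^2 / 2) under the normal law with mean mu_k and variance M_kk. *)
Definition update_mass (M : 'M[R]_n) (mu : 'cV[R]_n) (k : 'I_n) (l : R) :=
  (Num.sqrt (1 + l * M k k))^-1 * expR (- (l * mu k ord0 ^+ 2) / (2 * (1 + l * M k k))).

Lemma gaussian_state_update W C M mu A v k l : 0 < l ->
  gaussian_state W C M mu A v ->
  gaussian_state (fun w => W w * sq_weight l k w) (C * update_mass M mu k l)
    (M - (l / (1 + l * M k k)) *: (M *m e_ k *m (e_ k)^T *m M))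
    (mu - (l * mu k ord0 / (1 + l * M k k)) *: (M *m e_ k))
    (A + l *: (e_ k *m (e_ k)^T)) v.
Proof.
move=> l0 [mW W01 tW [C0 pA AM Amu]].
have pM := pos_def_inverse pA AM.
have Mk : 0 < M k k by exact: pos_def_diag.
have q0 : 0 < 1 + l * M k k by rewrite addr_gt0// mulr_gt0.
have [? ?] := Sherman_Morrison AM Amu (lt0r_neq0 q0).
split.
- by apply: measurable_funM => //; exact: measurable_sq_weight.
- move=> w; have /andP[? ?] := W01 w; have /andP[? ?] := sq_weight01 k w (ltW l0).
  by rewrite mulr_ge0//= mulr_ile1.
- apply: gaussian_transform_update => //; exact: (pos_def_inverse_sym pA AM).
- split=> //; last exact: pos_def_add_diag (ltW l0) pA.
  by rewrite mulr_gt0// mulr_gt0 ?expR_gt0// invr_gt0 sqrtr_gt0.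
Qed.

Lemma gaussian_state_mass W C M mu A v :
  gaussian_state W C M mu A v -> \int[P]_w W w = C.
Proof.
move=> [_ _ /(_ 0 0)]; rewrite trmx0 !mul0mx !mxE oppr0 mul0r expR0 addr0 cos0 !mulr1.
move=> <- _; apply: eq_Rintegral => w _; rewrite big1 ?addr0 ?cos0 ?mulr1//.
by move=> k _; rewrite mxE mul0r.
Qed.

(** [M'] and [mu'] are left implicit: the state pins them down through the updated precision matrix
    and the unchanged [v], so the iterated rank one formulas need not be unfolded. *)
Lemma gaussian_state_seq W C M mu A v (r : seq 'I_n) (t : R) : 0 < t ->
  gaussian_state W C M mu A v ->
  exists C' M' mu',
    gaussian_state (fun w => W w * \prod_(k <- r) sq_weight t k w) C' M' mu'
      (A + t *: \sum_(k <- r) (e_ k *m (e_ k)^T)) v.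
Proof.
move=> t0 s0; elim: r => [|k r [C' [M' [mu' IH]]]].
  exists C, M, mu; rewrite big_nil scaler0 addr0.
  by under eq_fun do rewrite big_nil mulr1.
have := gaussian_state_update k t0 IH.
set C2 := C' * _; set M2 := M' - _; set mu2 := mu' - _ => s2.
exists C2, M2, mu2; rewrite big_cons scalerDr [t *: _ + _]addrC addrA.
under eq_fun do rewrite big_cons [sq_weight _ _ _ * _]mulrC mulrA.
exact: s2.
Qed.

(** Squaring removes the square roots and leaves e^x <= r / r', where x is the left-hand side of the
    conclusion; then 1 + x <= e^x makes the inequality rational. *)
Lemma mass_comparison (r r' u u' : R) : 0 < r -> 0 < r' ->
  (Num.sqrt r)^-1 * expR (- u ^+ 2 / (2 * r)) <=
    (Num.sqrt r')^-1 * expR (- u' ^+ 2 / (2 * r')) ->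
  u' ^+ 2 / r' - u ^+ 2 / r <= r / r' - 1.
Proof.
move=> r0 r'0.
have sq (x y : R) : 0 < x ->
    ((Num.sqrt x)^-1 * expR (- y ^+ 2 / (2 * x))) ^+ 2 = x^-1 * expR (- (y ^+ 2 / x)).
  move=> x0; rewrite exprMn exprVn sqr_sqrtr ?ltW// expr2 -expRD; congr (_ * expR _).
  by field; rewrite gt_eqF.
move=> h; have : r^-1 * expR (- (u ^+ 2 / r)) <= r'^-1 * expR (- (u' ^+ 2 / r')).
  rewrite -!sq// ler_pXn2r ?nnegrE ?mulr_ge0 ?expR_ge0 ?invr_ge0 ?sqrtr_ge0//.
rewrite ler_pdivrMl// mulrA => {}h.
apply: (@le_trans _ _ (expR (u' ^+ 2 / r' - u ^+ 2 / r) - 1)).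
  by rewrite lerBrDl expR_ge1Dx.
rewrite lerB// -(ler_pM2r (expR_gt0 (- (u' ^+ 2 / r')))) -expRD.
by rewrite (_ : _ - _ + _ = - (u ^+ 2 / r))//; ring.
Qed.

(** After cancellation, the hypothesis says that the weight at j has at least as large a normalised
    mass under the law already weighted at i as under the original one. With c = M_ij and p = 1 +
    M_ii, the weight at i turns the variance M_jj into M_jj - c^2 / p and the mean mu_j into mu_j -
    c mu_i / p. By [mass_comparison] the squared mean grows by at most c^2 / p, and it grows by at
    least - 2 c mu_i mu_j / p. *)
Lemma four_point_gaussian W C M mu A v (i j : 'I_n) :
  gaussian_state W C M mu A v -> i != j ->
  (\int[P]_w (W w * sq_weight 1 i w)) * (\int[P]_w (W w * sq_weight 1 j w)) <=
    (\int[P]_w W w) * (\int[P]_w (W w * sq_weight 1 i w * sq_weight 1 j w)) ->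
  0 <= M i j ^+ 2 + 2 * M i j * mu i ord0 * mu j ord0.
Proof.
move=> s0 ij.
have si := gaussian_state_update i ltr01 s0.
have sj := gaussian_state_update j ltr01 s0.
have sij := gaussian_state_update j ltr01 si.
rewrite (gaussian_state_mass si) (gaussian_state_mass sj) (gaussian_state_mass s0).
rewrite (gaussian_state_mass sij).
have [_ _ _ [C0 pA AM _]] := s0.
have [_ _ _ [C'0 pA' A'M' _]] := si.
have pM := pos_def_inverse pA AM.
have pM' := pos_def_inverse pA' A'M'.
have Mi : 0 < M i i := pos_def_diag _ pM.
have Mj : 0 < M j j := pos_def_diag _ pM.
have := pos_def_diag j pM'.
have sM : M j i = M i j by rewrite -[in LHS](proj1 pM) mxE.
have M'E : (M - 1 / (1 + 1 * M i i) *: (M *m e_ i *m (e_ i)^T *m M)) j j =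
    M j j - M i j ^+ 2 / (1 + M i i).
  by rewrite [LHS]mxE [X in _ + X]mxE [X in - X]mxE rank1_entry sM !mul1r expr2 mulrC.
have E2 : (mu - (1 * mu i ord0 / (1 + 1 * M i i)) *: (M *m e_ i)) j ord0 =
    mu j ord0 - M i j * mu i ord0 / (1 + M i i).
  by rewrite [LHS]mxE [X in _ + X]mxE [X in - X]mxE -colE mxE sM !mul1r; ring.
move=> M'j.
rewrite (mulrCA C (C * update_mass M mu i 1)) (ler_pM2l C'0) (ler_pM2l C0) /update_mass.
rewrite E2 M'E !mul1r.
move: M'j; rewrite M'E.
set c := M i j; set p := 1 + M i i; set r := 1 + M j j.
move: (mu i ord0) (mu j ord0) => ui uj M'j H.
have p0 : 0 < p by rewrite addr_gt0.
have r0 : 0 < r by rewrite addr_gt0.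
have r'0 : 0 < r - c ^+ 2 / p by rewrite /r -addrA addr_gt0.
rewrite addrA -/r in H.
have := mass_comparison r0 r'0 H.
rewrite -(ler_pM2r r'0) mulrBl mulrVK ?unitfE ?gt_eqF// mulrBl mulrVK ?unitfE ?gt_eqF// mul1r.
(* The variance has decreased, so replacing this term by [uj ^+ 2] only weakens the bound and
   removes the denominator [r]. *)
have : uj ^+ 2 / r * (r - c ^+ 2 / p) <= uj ^+ 2.
  rewrite mulrBr mulrVK ?unitfE ?gt_eqF// lerBlDr lerDl.
  by apply: mulr_ge0; rewrite divr_ge0 ?sqr_ge0// ltW.
move=> h1 h2.
have h3 : (uj - c * ui / p) ^+ 2 - uj ^+ 2 <= c ^+ 2 / p by lra.
have h4 : - (2 * c * ui * uj / p) <= c ^+ 2 / p.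
  apply: le_trans h3.
  rewrite -subr_ge0 (_ : _ - _ = (c * ui / p) ^+ 2) ?sqr_ge0//; ring.
move: h4; rewrite -(ler_pM2r p0) mulNr !mulrVK ?unitfE ?gt_eqF//; lra.
Qed.

End gaussian_state.

(** * Expectations of products, equality in law and independence *)

Lemma bounded_integrable d (T : measurableType d) (R : realType) (P : probability T R)
    (f : T -> R) (K : R) :
  measurable_fun setT f -> (forall w, `|f w| <= K) -> P.-integrable setT (EFin \o f).
Proof.
move=> mf fK; have := integrable_bounded_mul (finite_measure_integrable_cst P 1 measurableT) mf fK.
by apply: eq_integrable => // w _; rewrite /= mul1r.
Qed.

Lemma probability_Rintegral_cst d (T : measurableType d) (R : realType)
    (P : probability T R) (c : R) : \int[P]_w c = c.
Proof.
transitivity (c * fine (P setT)); last by rewrite probability_setT mulr1.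
exact: (Rintegral_cst P measurableT c).
Qed.

Section product_expectation.
Context (R : realType).

Definition prod_expectation d (T : measurableType d) (P : probability T R) (I : finType)
    (X : I -> T -> R) (f : I -> R -> R) : R :=
  \int[P]_w \prod_i f i (X i w).

Section one_space.
Context d (T : measurableType d) (P : probability T R) (I : finType).
Variable X : I -> T -> R.
Hypothesis mX : forall i, measurable_fun setT (X i).

Lemma unit_valued_prod (f : I -> R -> R) (p : pred I) : (forall i, unit_valued (f i)) ->
  unit_valued (fun w => \prod_(i | p i) f i (X i w)).
Proof.
move=> uf; split.
  rewrite (_ : (fun w => _) = (fun w => \prod_(i <- enum p) f i (X i w))); last first.
    by apply/funext => w; rewrite big_enum.
  apply: measurable_prod => i _; apply: measurableT_comp => //.
  by have [] := uf i.
move=> w; apply/andP; split.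
  by apply: prodr_ge0 => i _; have [_ /(_ (X i w))/andP[]] := uf i.
by apply: Num.Theory.prodr_ile1 => i _; have [_ /(_ (X i w))] := uf i.
Qed.

Lemma midpoint_affine_prod_expectation (c : R) (f : I -> R -> R) (i : I) :
  (forall i, unit_valued (f i)) ->
  midpoint_affine (fun g => c * prod_expectation P X (upd f i g)).
Proof.
move=> uf.
have [mW W01] := unit_valued_prod (fun j => j != i) uf.
rewrite (_ : (fun g => _) = (fun g =>
    c * \int[P]_w ((\prod_(j | j != i) f j (X j w)) * g (X i w)))); last first.
  apply/funext => g; congr (_ * _); apply: eq_Rintegral => w _.
  rewrite (bigD1 i)//= mulrC /upd eqxx; congr (_ * _).
  by apply: eq_bigr => j /negbTE ->.
apply: midpoint_affine_integral => //.
- by apply: (@bounded_integrable _ _ _ _ _ 1) => // w; have /andP[? ?] := W01 w; rewrite ger0_norm.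
- by move=> w; have /andP[] := W01 w.
Qed.

Lemma measurable_box (B : I -> set R) : (forall i, measurable (B i)) ->
  measurable [set w | forall i, B i (X i w)].
Proof.
move=> mB.
rewrite (_ : [set w | _] = \bigcap_(i in setT) (X i @^-1` B i)).
  apply: fin_bigcap_measurable; first exact: finite_finset.
  by move=> i _; rewrite -[X in measurable X]setTI; exact: mX.
by apply/seteqP; split=> w /= H i; [move=> _|]; exact: H.
Qed.

Lemma prod_expectation_indic (B : I -> set R) : (forall i, measurable (B i)) ->
  prod_expectation P X (fun i => \1_(B i)) = fine (P [set w | forall i, B i (X i w)]).
Proof.
move=> mB; have mE := measurable_box mB.
rewrite /prod_expectation /Rintegral; congr fine.
set S := [set w | _] in mE *.
have <- : (\int[P]_w (\1_S w)%:E = P S)%E by rewrite integral_indic// setIT.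
apply: eq_integral => w _; congr (_%:E).
rewrite indicE; case: (boolP (w \in _)) => [/set_mem /= H|/negP H].
  by rewrite big1// => i _; rewrite indicE mem_set.
have [i Hi] : exists i, ~ B i (X i w).
  by apply/existsNP => H'; apply: H; exact/mem_set.
by rewrite (bigD1 i)//= indicE memNset ?mul0r.
Qed.

End one_space.

Lemma law_eq_prod_expectation d1 d2 (T1 : measurableType d1) (T2 : measurableType d2)
    (P1 : probability T1 R) (P2 : probability T2 R) n
    (X : 'I_n -> T1 -> R) (Y : 'I_n -> T2 -> R) (f : 'I_n -> R -> R) :
  rvec_measurable X -> rvec_measurable Y -> law_eq P1 P2 X Y ->
  (forall i, unit_valued (f i)) ->
  prod_expectation P1 X f = prod_expectation P2 Y f.
Proof.
move=> mX mY XY; apply: midpoint_affine_family_ext => {}f.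
  move=> i uf; split.
    have := midpoint_affine_prod_expectation P1 mX 1 i uf.
    by under eq_fun do rewrite mul1r.
  have := midpoint_affine_prod_expectation P2 mY 1 i uf.
  by under eq_fun do rewrite mul1r.
by move=> mB; rewrite !prod_expectation_indic// XY.
Qed.

(** With slots indexed by pairs (k, i), independence on rectangles is exactly the indicator case of
    [midpoint_affine_family_ext]; changing the slot (k, i) affects only the k-th factor of the
    product. *)
Lemma iid_prod_expectation d (T : measurableType d) (P : probability T R) m n
    (Y : 'I_m -> 'I_n -> T -> R) (f : 'I_m * 'I_n -> R -> R) :
  (forall k, rvec_measurable (Y k)) -> iid_rvecs P Y ->
  (forall ki, unit_valued (f ki)) ->
  prod_expectation P (fun ki => Y ki.1 ki.2) f =
  \prod_k prod_expectation P (Y k) (fun i => f (k, i)).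
Proof.
move=> mY [indep _].
have mY2 ki : measurable_fun setT (Y ki.1 ki.2) by exact: mY.
apply: (midpoint_affine_family_ext
  (F2 := fun f => \prod_k prod_expectation P (Y k) (fun i => f (k, i)))) => {}f.
  move=> ki uf; split.
    have := midpoint_affine_prod_expectation P mY2 1 ki uf.
    by under eq_fun do rewrite mul1r.
  case: ki => k i.
  rewrite (_ : (fun g => _) = (fun g =>
      (\prod_(k' | k' != k) prod_expectation P (Y k') (fun i => f (k', i))) *
      prod_expectation P (Y k) (upd (fun i => f (k, i)) i g))); last first.
    apply/funext => g; rewrite (bigD1 k)//= mulrC; congr (_ * _).
      apply: eq_bigr => k' /negbTE k'k; congr prod_expectation; apply/funext => i'.
      by rewrite /upd xpair_eqE k'k.
    congr prod_expectation; apply/funext => i'.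
    by rewrite /upd xpair_eqE eqxx.
  exact: (midpoint_affine_prod_expectation P (mY k)).
move=> mB; rewrite prod_expectation_indic//.
have -> : [set w | forall ki : 'I_m * 'I_n, f ki (Y ki.1 ki.2 w)] =
    [set w | forall k i, f (k, i) (Y k i w)].
  by apply/seteqP; split=> w /= H; [move=> k i; exact: (H (k, i))|case=> k i; exact: H].
rewrite (indep (fun k i => f (k, i)))//.
have E k : P [set w | forall i, f (k, i) (Y k i w)] =
    (fine (P [set w | forall i, f (k, i) (Y k i w)]))%:E.
  by rewrite fineK// fin_num_measure//; exact: (measurable_box (mY k) (B := fun i => f (k, i))).
transitivity (fine (\prod_k (fine (P [set w | forall i, f (k, i) (Y k i w)]))%:E)%E).
  by congr fine; apply: eq_bigr => k _; exact: E.
rewrite prodEFin /=; apply: eq_bigr => k _.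
by rewrite prod_expectation_indic//; exact: mY.
Qed.

End product_expectation.

(** * Laplace transforms of infinitely divisible nonnegative vectors *)

Section infinitely_divisible.
Context d (T : measurableType d) (R : realType) (P : probability T R) (n : nat).
Variable Z : 'I_n -> T -> R.
Hypothesis mZ : rvec_measurable Z.
Hypothesis Z0 : forall i w, 0 <= Z i w.

(* If Y_k takes negative values with probability p, their sum does so with probability >= p^m. *)
Lemma summand_ge0 d' (T' : measurableType d') (P' : probability T' R) m
    (Y : 'I_m -> 'I_n -> T' -> R) :
  (forall k, rvec_measurable (Y k)) -> iid_rvecs P' Y ->
  law_eq P P' Z (fun i w => \sum_k Y k i w) ->
  {ae P', forall w k i, 0 <= Y k i w}.
Proof.
move=> mY [indep same] ZY.
pose B (i i' : 'I_n) : set R := if i' == i then `]-oo, 0[%classic else setT.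
have mB i i' : measurable (B i i') by rewrite /B; case: ifP.
have Bx i (x : 'I_n -> R) : (forall i', B i i' (x i')) = (x i < 0).
  apply/propext; split=> [/(_ i)|xi i']; rewrite /B ?eqxx /= ?in_itv//=.
  by case: eqP => [->|]//; rewrite in_itv.
have YB k i w : (forall i', B i i' (Y k i' w)) = (Y k i w < 0) := Bx i (fun i' => Y k i' w).
have mltYi k i : measurable [set w | Y k i w < 0].
  rewrite (_ : [set w | _] = [set w | forall i', B i i' (Y k i' w)]).
    exact: (measurable_box (mY k) (mB i)).
  by apply/funext => w; rewrite /= Bx.
have neg0 k i : P' [set w | Y k i w < 0] = 0%E.
  have boxE k' : [set w | forall i', B i i' (Y k' i' w)] = [set w | Y k' i w < 0].
    by apply/funext => w; rewrite /= Bx.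
  have sameE k' : P' [set w | forall i', B i i' (Y k' i' w)] =
      (fine (P' [set w | Y k i w < 0]))%:E.
    by rewrite fineK ?fin_num_measure// (same k' k)// boxE.
  have := indep (fun _ => B i) (fun _ => mB i).
  under eq_bigr do rewrite sameE.
  rewrite prodEFin prodr_const card_ord => H.
  suff : P' [set w | forall k' i', B i i' (Y k' i' w)] = 0%E.
    rewrite H => -[] /eqP; rewrite expf_eq0 => /andP[_ /eqP p0].
    by rewrite -[LHS]fineK ?p0// fin_num_measure.
  have msum i' : measurable_fun setT (fun w => \sum_k Y k i' w).
    by apply: measurable_sum => k'; exact: mY.
  apply/eqP; rewrite eq_le measure_ge0 andbT.
  have <- : P' [set w | forall i', B i i' (\sum_k Y k i' w)] = 0%E.
    rewrite -(ZY (B i) (mB i)) (_ : [set w | _] = set0) ?measure0//.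
    by apply/seteqP; split=> w //=; rewrite Bx ltNge Z0.
  apply: le_measure.
  - rewrite inE (_ : [set w | _] = \bigcap_(k' in setT) [set w | Y k' i w < 0]).
      by apply: fin_bigcap_measurable; first exact: finite_finset.
    apply/seteqP; split=> w /= H' k'; first by move=> _ /=; rewrite -YB; exact: H'.
    by rewrite YB; exact: (H' k' Logic.I).
  - by rewrite inE; exact: (measurable_box msum (mB i)).
  - move=> w /= H'; rewrite (Bx i (fun i' => \sum_k Y k i' w)).
    have neg k' : Y k' i w < 0 by rewrite -YB.
    rewrite (bigD1 k)//= -[ltRHS]addr0 ltr_leD// sumr_le0// => k' _; exact: ltW.
have ae_neg (k : 'I_m) (i : 'I_n) : {ae P', forall w, 0 <= Y k i w}.
  exists [set w | Y k i w < 0]; split => //.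
  by move=> w /=; rewrite ltNge => /negP.
have ae_seq (s : seq ('I_m * 'I_n)) :
    {ae P', forall w, forall ki, ki \in s -> 0 <= Y ki.1 ki.2 w}.
  elim: s => [|[k i] s IH]; first exact: aeW.
  apply: filterS2 (ae_neg k i) IH => w h1 h2 ki.
  by rewrite in_cons => /orP[/eqP ->|/h2].
apply: filterS (ae_seq (enum {: 'I_m * 'I_n})) => w H k i.
by apply: (H (k, i)); rewrite mem_enum.
Qed.

(* The truncation makes expo bounded on the whole line; it is inactive on nonnegative vectors. *)
Definition expo (l z : R) : R := expR (- (l * Num.max z 0) / 2).

(** The Laplace transform at l / 2: the factor 1/2 in [expo] makes the weight of a squared
    coordinate coincide with [sq_weight]. *)
Definition laplace d' (T' : measurableType d') (P' : probability T' R)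
  (X : 'I_n -> T' -> R) (l : 'I_n -> R) := prod_expectation P' X (fun i => expo (l i)).

Lemma unit_valued_expo l : 0 <= l -> unit_valued (expo l).
Proof.
move=> l0; split.
  apply: measurableT_comp => //; apply: measurable_funM => //.
  apply: measurableT_comp => //; apply: measurable_funM => //.
  exact: measurable_maxr.
move=> z; rewrite expR_ge0 -expR0 ler_expR mulNr oppr_le0.
by rewrite divr_ge0// mulr_ge0// le_max lexx orbT.
Qed.

Lemma expo_sum m l (y : 'I_m -> R) : (forall k, 0 <= y k) ->
  expo l (\sum_k y k) = \prod_k expo l (y k).
Proof.
move=> y0; rewrite /expo -expR_sum; congr expR.
rewrite max_l ?sumr_ge0// mulr_sumr -sumrN mulr_suml.
by apply: eq_bigr => k _; rewrite max_l.
Qed.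

(** The exponential of a sum of nonnegative terms is a product over the summands; independence
    splits its expectation and the common law makes the factors equal. With [m.+1] summands, [ord0]
    names one of them. *)
Lemma laplace_pow d' (T' : measurableType d') (P' : probability T' R) m
    (Y : 'I_m.+1 -> 'I_n -> T' -> R) l : (forall k, 0 <= l k) ->
  (forall k, rvec_measurable (Y k)) -> iid_rvecs P' Y ->
  law_eq P P' Z (fun i w => \sum_k Y k i w) ->
  laplace P Z l = laplace P' (Y ord0) l ^+ m.+1.
Proof.
move=> l0 mY iY ZY.
have ue i : unit_valued (expo (l i)) by exact: unit_valued_expo.
have mS : rvec_measurable (fun i w => \sum_k Y k i w).
  by move=> i; apply: measurable_sum => k; exact: mY.
rewrite /laplace (law_eq_prod_expectation mZ mS ZY ue).
transitivity (prod_expectation P' (fun ki => Y ki.1 ki.2)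
   (fun ki : 'I_m.+1 * 'I_n => expo (l ki.2))).
  rewrite /prod_expectation /Rintegral; congr fine; apply: ae_eq_integral => //.
  - by apply/measurable_EFinP; have [] := unit_valued_prod mS xpredT ue.
  - apply/measurable_EFinP.
    by have [] := unit_valued_prod (fun ki => mY ki.1 ki.2) xpredT (fun ki => ue ki.2).
  (* Only almost everywhere: [expo] turns sums into products where all summands are nonnegative. *)
  - apply: filterS (summand_ge0 mY iY ZY) => w Y0 _; congr (_%:E).
    under eq_bigr do rewrite expo_sum//.
    by rewrite exchange_big pair_big.
rewrite (iid_prod_expectation (f := fun ki => expo (l ki.2)) mY iY (fun ki => ue ki.2)).
have [_ same] := iY.
under eq_bigr => k _ do rewrite (law_eq_prod_expectation (mY k) (mY ord0) (same k ord0) ue).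
by rewrite prodr_const card_ord.
Qed.

Definition shift_at (l : 'I_n -> R) (i : 'I_n) (k : 'I_n) : R := l k + (k == i)%:R.

Lemma prod_expo_shift l i (x : 'I_n -> R) :
  \prod_k expo (shift_at l i k) (x k) = (\prod_k expo (l k) (x k)) * expo 1 (x i).
Proof.
rewrite (bigD1 i)//= [in RHS](bigD1 i)//= [RHS]mulrAC; congr (_ * _).
  by rewrite /expo -expRD; congr expR; rewrite /shift_at eqxx /=; field.
by apply: eq_bigr => k /negbTE ki; rewrite /shift_at ki addr0.
Qed.

Lemma laplace_four_point d' (T' : measurableType d') (P' : probability T' R)
    (X : 'I_n -> T' -> R) l i j : rvec_measurable X -> (forall k, 0 <= l k) ->
  laplace P' X (shift_at l i) + laplace P' X (shift_at l j) <=
  laplace P' X l + laplace P' X (shift_at (shift_at l i) j).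
Proof.
move=> mX l0.
have shift0 l' k0 : (forall k, 0 <= l' k) -> forall k, 0 <= shift_at l' k0 k.
  by move=> l'0 k; rewrite addr_ge0.
have int l' : (forall k, 0 <= l' k) ->
    P'.-integrable setT (EFin \o (fun w => \prod_k expo (l' k) (X k w))).
  move=> l'0; have [mf f01] := unit_valued_prod mX xpredT (fun k => unit_valued_expo (l'0 k)).
  by apply: (@bounded_integrable _ _ _ _ _ 1) => // w; have /andP[? ?] := f01 w; rewrite ger0_norm.
have intD (f g : T' -> R) : P'.-integrable setT (EFin \o f) -> P'.-integrable setT (EFin \o g) ->
    P'.-integrable setT (EFin \o (fun w => f w + g w)).
  move=> fi gi; have := integrableD measurableT fi gi.
  by apply: eq_integrable => // w _; rewrite /= EFinD.
have bi := shift0 _ i l0; have bj := shift0 _ j l0; have bij := shift0 _ j bi.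
rewrite /laplace /prod_expectation -!RintegralD//;
  [|exact: int l0|exact: int bij|exact: int bi|exact: int bj].
apply: le_Rintegral => //.
- exact: intD (int _ bi) (int _ bj).
- exact: intD (int _ l0) (int _ bij).
move=> w _.
have E (l' : 'I_n -> R) k0 := prod_expo_shift l' k0 (fun k => X k w).
rewrite (E l i) (E l j) (E (shift_at l i) j) (E l i).
set W := \prod_k _; set a := expo _ _; set b := expo _ _.
have W0 : 0 <= W by apply: prodr_ge0 => k _; exact: expR_ge0.
have /andP[_ a1] : 0 <= a <= 1 by apply: (proj2 (unit_valued_expo ler01)).
have /andP[_ b1] : 0 <= b <= 1 by apply: (proj2 (unit_valued_expo ler01)).
rewrite -subr_ge0 (_ : _ - _ = W * ((1 - a) * (1 - b))); last by ring.
by rewrite !mulr_ge0// subr_ge0.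
Qed.

(** Since e^(- y) >= 1 - y > 0, e^y is at most 1 / (1 - y), while (1 + y + y^2) (1 - y) = 1 - y^3 >=
    1. *)
Lemma expR_le_quad (y : R) : y <= 0 -> expR y <= 1 + y + y ^+ 2.
Proof.
move=> y0; have y1 : 0 < 1 - y by lra.
have : expR y * (1 - y) <= 1.
  rewrite -ler_pdivlMl ?expR_gt0// mulr1 -expRN; exact: expR_ge1Dx.
rewrite -ler_pdivlMr// => /le_trans; apply.
rewrite ler_pdivrMr//.
have -> : (1 + y + y ^+ 2) * (1 - y) = 1 + y ^+ 2 * (- y) by ring.
by rewrite lerDl mulr_ge0 ?sqr_ge0// oppr_ge0.
Qed.

(** The roots of order M = m + 1 are e^(y / M) with y = ln x. Bounding the left side of the additive
    inequality below by 1 + y / M and the right side above by [expR_le_quad], then multiplying by M,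
    gives y1 + y2 <= y0 + y3 up to an error (y0^2 + y3^2) / M. Having all x at most 1 makes the
    logarithms nonpositive, as the quadratic bound requires. *)
Lemma le_mul_of_roots (x0 x1 x2 x3 : R) :
  0 < x0 <= 1 -> 0 < x1 <= 1 -> 0 < x2 <= 1 -> 0 < x3 <= 1 ->
  (forall m : nat, exists a0 a1 a2 a3 : R,
    [/\ [/\ 0 <= a0, 0 <= a1, 0 <= a2 & 0 <= a3],
        [/\ a0 ^+ m.+1 = x0, a1 ^+ m.+1 = x1, a2 ^+ m.+1 = x2 & a3 ^+ m.+1 = x3] &
        a1 + a2 <= a0 + a3]) ->
  x1 * x2 <= x0 * x3.
Proof.
move=> x0P x1P x2P x3P H.
have rootE m (a x : R) : 0 < x <= 1 -> 0 <= a -> a ^+ m.+1 = x -> a = expR (ln x / m.+1%:R).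
  move=> /andP[x_gt0 _] a0 ax; apply: (@pexpIrn _ m.+1) => //; rewrite ?nnegrE ?expR_ge0//.
  by rewrite ax -expRM_natl mulrC divfK ?lnK ?posrE.
have lnle (x : R) : 0 < x <= 1 -> ln x <= 0 by move=> /andP[_]; exact: ln_le0.
pose y0 := ln x0; pose y1 := ln x1; pose y2 := ln x2; pose y3 := ln x3.
have key m : y1 + y2 - (y0 + y3) <= (y0 ^+ 2 + y3 ^+ 2) / m.+1%:R.
  have [a0 [a1 [a2 [a3 [[p0 p1 p2 p3] [e0 e1 e2 e3] a]]]]] := H m.
  move: a; rewrite (rootE m _ _ x0P p0 e0) (rootE m _ _ x1P p1 e1).
  rewrite (rootE m _ _ x2P p2 e2) (rootE m _ _ x3P p3 e3) -/y0 -/y1 -/y2 -/y3.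
  set M : R := m.+1%:R; have M0 : 0 < M by rewrite ltr0n.
  have q0 : expR (y0 / M) <= 1 + y0 / M + (y0 / M) ^+ 2.
    by apply: expR_le_quad; rewrite ler_pdivrMr// mul0r lnle.
  have q3 : expR (y3 / M) <= 1 + y3 / M + (y3 / M) ^+ 2.
    by apply: expR_le_quad; rewrite ler_pdivrMr// mul0r lnle.
  have q1 := expR_ge1Dx (y1 / M); have q2 := expR_ge1Dx (y2 / M).
  move=> h.
  have : (y1 + y2 - (y0 + y3)) / M <= (y0 ^+ 2 + y3 ^+ 2) / M / M.
    have -> : (y0 ^+ 2 + y3 ^+ 2) / M / M = (y0 / M) ^+ 2 + (y3 / M) ^+ 2.
      by field; rewrite gt_eqF.
    have -> : (y1 + y2 - (y0 + y3)) / M = y1 / M + y2 / M - (y0 / M + y3 / M) by ring.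
    move: q0 q1 q2 q3 h; move: (y0 / M) (y1 / M) (y2 / M) (y3 / M) => Y0 Y1 Y2 Y3.
    move: (expR Y0) (expR Y1) (expR Y2) (expR Y3) (Y0 ^+ 2) (Y3 ^+ 2) => *.
    lra.
  by rewrite ler_pM2r ?invr_gt0.
have yle : y1 + y2 <= y0 + y3.
  rewrite -subr_le0; apply/ler_addgt0Pl => e e0; rewrite addr0.
  pose m := Num.bound ((y0 ^+ 2 + y3 ^+ 2) / e).
  apply: le_trans (key m) _.
  rewrite ler_pdivrMr ?ltr0n// mulrC -ler_pdivrMr//.
  have : (y0 ^+ 2 + y3 ^+ 2) / e < m%:R.
    by apply: archi_boundP; rewrite divr_ge0 ?addr_ge0 ?sqr_ge0// ltW.
  by move=> /ltW /le_trans; apply; rewrite ler_nat.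
have E (x : R) : 0 < x <= 1 -> x = expR (ln x) by move=> /andP[? _]; rewrite lnK ?posrE.
by rewrite (E _ x0P) (E _ x1P) (E _ x2P) (E _ x3P) -!expRD ler_expR.
Qed.

Lemma laplace_bounds l : (forall k, 0 <= l k) -> 0 < laplace P Z l <= 1.
Proof.
move=> l0.
have [mf f01] := unit_valued_prod mZ xpredT (fun k => unit_valued_expo (l0 k)).
pose f w := \prod_k expo (l k) (Z k w).
have fi : P.-integrable setT (EFin \o f).
  by apply: (@bounded_integrable _ _ _ _ _ 1) => // w; have /andP[? ?] := f01 w; rewrite ger0_norm.
have f0 w : 0 < f w by apply: prodr_gt0 => k _; exact: expR_gt0.
apply/andP; split; last first.
  have <- : \int[P]_w (cst 1 w) = 1 :> R by exact: probability_Rintegral_cst.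
  apply: le_Rintegral => //; first exact: finite_measure_integrable_cst.
  by move=> w _; have /andP[] := f01 w.
rewrite lt_def; apply/andP; split; last by apply: Rintegral_ge0 => w _; exact: ltW (f0 w).
apply/negP => /eqP lap0.
have int0 : (\int[P]_w `|(f w)%:E| = 0)%E.
  have -> : (\int[P]_w `|(f w)%:E| = (laplace P Z l)%:E)%E.
    rewrite /laplace /prod_expectation /Rintegral fineK; last exact: integrable_fin_num fi.
    by apply: eq_integral => w _; rewrite gee0_abs// lee_fin ltW.
  by rewrite lap0.
have mEf : measurable_fun setT (EFin \o f) by exact/measurable_EFinP.
have [N [mN PN0 fN]] := (ae_eq_integral_abs P measurableT mEf).1 int0.
(* The null set [N] contains every point where [f] is nonzero, hence the whole space. *)
have NT : N = setT.
  apply/seteqP; split=> // w _; apply: fN => /= /(_ Logic.I) [] fw0.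
  by have := f0 w; rewrite fw0 ltxx.
by have := @probability_setT _ _ _ P; rewrite -NT PN0 => /eqP; rewrite eq_sym onee_eq0.
Qed.

Lemma inf_divisible_laplace l i j : inf_divisible P Z -> (forall k, 0 <= l k) ->
  laplace P Z (shift_at l i) * laplace P Z (shift_at l j) <=
  laplace P Z l * laplace P Z (shift_at (shift_at l i) j).
Proof.
move=> idZ l0.
have shift0 l' k0 : (forall k, 0 <= l' k) -> forall k, 0 <= shift_at l' k0 k.
  by move=> l'0 k; rewrite addr_ge0.
have bi := shift0 _ i l0; have bj := shift0 _ j l0; have bij := shift0 _ j bi.
apply: le_mul_of_roots; try exact: laplace_bounds.
move=> m; have [d' [T' [P' [Y [mY [iY ZY]]]]]] := idZ m.+1 isT.
have lap0 l' : 0 <= laplace P' (Y ord0) l'.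
  by apply: Rintegral_ge0 => w _; apply: prodr_ge0 => k _; exact: expR_ge0.
exists (laplace P' (Y ord0) l), (laplace P' (Y ord0) (shift_at l i)),
  (laplace P' (Y ord0) (shift_at l j)), (laplace P' (Y ord0) (shift_at (shift_at l i) j)).
split; first by split.
  by split; rewrite -laplace_pow.
exact: laplace_four_point.
Qed.

End infinitely_divisible.

(** * The transform of a shifted Gaussian vector *)

(** Each linear combination of G is one-dimensional normal by hypothesis, so the cosine integral for
    a normal law applies; the shift by alpha only moves the phase. *)
Lemma gaussian_transform_base d (T : measurableType d) (R : realType)
    (P : probability T R) n (G : 'I_n -> T -> R) (Gamma : 'M[R]_n) (alpha : R) :
  centered_gaussian P G Gamma -> pos_def Gamma ->
  gaussian_transform P (fun k w => G k w + alpha) (fun=> 1) 1 Gamma (const_mx alpha).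
Proof.
move=> [mG lawG] [_ pG] th c.
pose u i := th i ord0.
have vE : \sum_i \sum_j u i * u j * Gamma i j = (th^T *m Gamma *m th) ord0 ord0.
  rewrite exchange_big [RHS]mxE; apply: eq_bigr => j _.
  rewrite mxE mulr_suml; apply: eq_bigr => i _; rewrite !mxE /u; ring.
pose S w := \sum_i u i * G i w.
pose c' := (th^T *m (const_mx alpha : 'cV[R]_n)) ord0 ord0 + c.
have SE w : \sum_k th k ord0 * (G k w + alpha) + c = S w + c'.
  rewrite /c' addrA; congr (_ + _); rewrite [in RHS]mxE /S -big_split /=.
  by apply: eq_bigr => k _; rewrite !mxE mulrDr.
have mS : measurable_fun setT S.
  by apply: measurable_sum => i; apply: measurable_funM => //; exact: mG.
under eq_Rintegral do rewrite SE.
(* For th = 0 the combination has variance 0 and its law is a Dirac mass; otherwise definiteness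
   gives a positive standard deviation. *)
rewrite mul1r -/c'; have [th0|th0] := eqVneq th 0.
  have -> : (th^T *m Gamma *m th) ord0 ord0 = 0 by rewrite th0 mulmx0 mxE.
  rewrite oppr0 mul0r expR0 mul1r.
  under eq_Rintegral => w _.
    rewrite mul1r /S big1 ?add0r; last by move=> i _; rewrite /u th0 mxE mul0r.
    over.
  exact: probability_Rintegral_cst.
have v0 := pG th th0.
have s0 : 0 < Num.sqrt ((th^T *m Gamma *m th) ord0 ord0) by rewrite sqrtr_gt0.
have c1 x : `|cos (1 * x + c')| <= 1 by exact: norm_cos_le1.
transitivity (1 * \int[normal_prob 0 (Num.sqrt ((th^T *m Gamma *m th) ord0 ord0))]_x
   (1 * cos (1 * x + c'))).
  transitivity (\int[P]_w (cst 1 w * (fun x => cos (1 * x + c')) (S w))).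
    by apply: eq_Rintegral => w _; rewrite /= (mul1r (S w)).
  have ext := @weighted_integral_ext _ _ _ _ _ _ R P
    (normal_prob 0 (Num.sqrt ((th^T *m Gamma *m th) ord0 ord0))) (cst 1) (cst 1) S id 1 1
    (finite_measure_integrable_cst _ 1 measurableT) (fun=> ler01) mS
    (finite_measure_integrable_cst _ 1 measurableT) (fun=> ler01) (@measurable_id _ _ setT).
  apply: (ext _ (fun x => cos (1 * x + c'))) => //.
  - move=> B mB; rewrite mul1r.
    under eq_Rintegral do rewrite mul1r.
    under [RHS]eq_Rintegral do rewrite mul1r.
    rewrite /Rintegral; congr fine; rewrite [RHS]integral_indic// setIT.
    transitivity (P [set w | B (S w)]); last by have := lawG u B mB; rewrite vE v0.
    transitivity (\int[P]_w (\1_(S @^-1` B) w)%:E)%E; first by [].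
    rewrite integral_indic ?setIT//.
    by rewrite -[X in measurable X]setTI; exact: mS.
  - exact: (continuous_measurable_fun (@continuous_cos_affine R 1 c')).
under eq_Rintegral do rewrite mul1r.
rewrite mul1r normal_prob_cos// mul1r mulr0 add0r sqr_sqrtr ?ltW//.
Qed.

(** * Inverses of M-matrices and the resolvent for large t *)

Section M_matrix_inverse.
Context (R : realType) (n : nat).
Implicit Types A M : 'M[R]_n.

Lemma quad_sum A (x y : 'cV[R]_n) :
  (x^T *m A *m y) ord0 ord0 = \sum_i \sum_j x i ord0 * A i j * y j ord0.
Proof.
rewrite exchange_big mxE; apply: eq_bigr => j _; rewrite mxE mulr_suml.
by apply: eq_bigr => i _; rewrite !mxE.
Qed.

(* Test A against the negative part of a column of M. *)
Lemma inverse_Zmatrix_ge0 A M : pos_def A -> (forall i j, i != j -> A i j <= 0) ->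
  A *m M = 1%:M -> forall i j, 0 <= M i j.
Proof.
move=> [sA pA] offA AM i j.
pose x : 'cV[R]_n := col j M.
pose y : 'cV[R]_n := \col_k Num.max (- M k j) 0.
have Ax : A *m x = delta_mx j ord0 by rewrite /x colE mulmxA AM mul1mx.
have [y0|y0] := eqVneq y 0.
  have := congr1 (fun z : 'cV[R]_n => z i ord0) y0.
  by rewrite /y !mxE => /eqP; rewrite eq_maxr oppr_le0.
have := pA y y0; rewrite ltNge => /negP; case.
have -> : (y^T *m A *m y) = y^T *m A *m (x + y) - y^T *m (A *m x).
  by rewrite mulmxDr mulmxA addrC addKr.
rewrite Ax -colE [X in X <= _]mxE [X in _ + X]mxE [X in - X]mxE [X in - X]mxE.
have yj : 0 <= y j ord0 by rewrite mxE le_max lexx orbT.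
rewrite subr_le0; apply: le_trans yj; rewrite quad_sum.
apply: sumr_le0 => k _; apply: sumr_le0 => l _.
have y_ge0 m : 0 <= y m ord0 by rewrite mxE le_max lexx orbT.
have z_ge0 m : 0 <= (x + y) m ord0.
  rewrite !mxE; case: (lerP 0 (M m j)) => h.
    by rewrite addr_ge0// le_max lexx orbT.
  by rewrite max_l ?subrr// oppr_ge0 ltW.
have [kl|kl] := eqVneq k l.
  rewrite -kl (_ : _ * _ = A k k * (y k ord0 * (x + y) k ord0)); last by ring.
  rewrite (_ : y k ord0 * _ = 0) ?mulr0// !mxE.
  case: (lerP 0 (M k j)) => h; first by rewrite max_r ?mul0r// oppr_le0.
  by rewrite max_l ?subrr ?mulr0// oppr_ge0 ltW.
by rewrite -mulrA mulr_ge0_le0// mulr_le0_ge0// offA.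
Qed.

(** Let y be column k of M with its entries in S erased. For l outside S, row l of A vanishes on S,
    so (A y)_l = (A M)_lk = 0, as l differs from k. Hence y^T A y = 0, and definiteness forces y =
    0. *)
Lemma block_inverse A M (S : {set 'I_n}) : pos_def A -> A *m M = 1%:M ->
  (forall i k, i \notin S -> k \in S -> A i k = 0) ->
  forall i k, i \notin S -> k \in S -> M i k = 0.
Proof.
move=> [sA pA] AM A0 i k iS kS.
pose y : 'cV[R]_n := \col_l (if l \in S then 0 else M l k).
have [y0|/pA] := eqVneq y 0.
  have := congr1 (fun z : 'cV[R]_n => z i ord0) y0.
  by rewrite /y !mxE (negbTE iS).
rewrite quad_sum big1 ?ltxx// => l _.
have [lS|lS] := boolP (l \in S).
  by rewrite big1// => m _; rewrite mxE lS !mul0r.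
under eq_bigr do rewrite -mulrA.
rewrite -mulr_sumr (_ : \sum_ _ _ = 0) ?mulr0//.
have lk : l != k by apply: contraNneq lS => ->.
have := congr1 (fun z : 'M[R]_n => z l k) AM; rewrite !mxE (negbTE lk) mulr0n => E0.
rewrite -[RHS]E0.
apply: eq_bigr => m _; rewrite mxE; case: ifP => // mS.
by rewrite A0// !mul0r.
Qed.

(* The zeros of a column of M would split A, hence Gamma, into blocks. *)
Lemma irreducible_inverse_gt0 A Gamma M t : pos_def Gamma -> irreducible_mx Gamma ->
  A *m Gamma = 1%:M -> pos_def A -> (forall i j, i != j -> A i j <= 0) ->
  0 <= t -> (A + t%:M) *m M = 1%:M -> pos_def (A + t%:M) ->
  forall i j, 0 < M i j.
Proof.
move=> [sG _] irrG AG pA offA t0 BM pB i j.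
have offB k l : k != l -> (A + t%:M) k l = A k l.
  by move=> kl; rewrite !mxE (negbTE kl) mulr0n addr0.
have M0 := inverse_Zmatrix_ge0 pB (fun k l kl => eq_ind_r (fun z => z <= 0) (offA k l kl) (offB k l kl)) BM.
pose S : {set 'I_n} := [set k | 0 < M k j]%SET.
have jS : j \in S by rewrite inE; exact: pos_def_diag (pos_def_inverse pB BM).
have AS k l : k \notin S -> l \in S -> A k l = 0.
  move=> kS lS.
  have kl : k != l by apply: contraNneq kS => ->.
  have kj : k != j by apply: contraNneq kS => ->.
  have Mk : M k j = 0.
    by apply/eqP; move: kS; rewrite inE -leNgt eq_le M0 andbT.
  have := congr1 (fun z : 'M[R]_n => z k j) BM; rewrite mxE [in RHS]mxE (negbTE kj) mulr0n.
  under eq_bigr do rewrite -[_ * _]opprK; rewrite sumrN => /eqP; rewrite oppr_eq0.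
  rewrite psumr_eq0 => [/allP/(_ l (mem_index_enum _))|m _].
    rewrite oppr_eq0 mulf_eq0 offB// => /orP[/eqP//|/eqP Ml].
    by move: lS; rewrite inE Ml ltxx.
  rewrite oppr_ge0; have [->|km] := eqVneq m k; first by rewrite Mk mulr0.
  by rewrite mulr_le0_ge0// offB 1?eq_sym// offA// eq_sym.
have GS := block_inverse pA AG AS.
have [ST|SnT] := eqVneq S [set: 'I_n]%SET.
  by have := finset.in_setT i; rewrite -ST inE.
case: irrG; exists S; split=> //.
  by apply/set0Pn; exists j.
move=> k l kS lS; have h := GS l k lS kS; split=> //.
by rewrite -[Gamma]sG mxE.
Qed.

(** If x is column j of M, then M_jj = x^T (A + t) x >= t |x|^2. The entry j of x gives M_jj <= 1 /
    t, and then every entry satisfies t M_ij^2 <= 1 / t. *)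
Lemma resolvent_bound A M t : pos_def A -> 0 < t -> (A + t%:M) *m M = 1%:M ->
  pos_def (A + t%:M) -> forall i j, `|M i j| <= t^-1.
Proof.
move=> [_ pA] t0 BM pB i j.
have pM := pos_def_inverse pB BM.
have sM : M^T = M by case: pM.
have Mj := pos_def_diag j pM.
have quad : t * \sum_l M l j ^+ 2 <= M j j.
  have -> : M j j = ((col j M)^T *m (A + t%:M) *m col j M) ord0 ord0.
    by rewrite -mulmxA colE (mulmxA _ M) BM mul1mx trmx_mul sM -colE mxE trmx_delta -rowE mxE.
  rewrite mulmxDr mulmxDl mxE mul_mx_scalar -scalemxAl.
  rewrite [X in _ + X](_ : _ = t * \sum_l M l j ^+ 2).
    rewrite lerDr; have [->|/pA/ltW//] := eqVneq (col j M) 0.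
    by rewrite mulmx0 mxE.
  rewrite !mxE; congr (_ * _); apply: eq_bigr => l _.
  by rewrite !mxE expr2.
have entry l : t * M l j ^+ 2 <= M j j.
  apply: le_trans quad; rewrite ler_pM2l// (bigD1 l)//= lerDl.
  by apply: sumr_ge0 => k _; rewrite sqr_ge0.
have Mjle : M j j <= t^-1.
  have := entry j; rewrite expr2 mulrA -[leRHS]mul1r ler_pM2r// => h.
  by rewrite -[leRHS]mul1r ler_pdivlMr// mulrC.
rewrite -(@ler_pXn2r R 2 isT) ?nnegrE ?invr_ge0 ?(ltW t0)// real_normK ?num_real//.
have := le_trans (entry i) Mjle; rewrite mulrC -ler_pdivlMr// => /le_trans; apply.
Qed.

(** Iterating t M = 1 - A M gives t^2 M = t - A + A^2 M, whose first term vanishes off the diagonal;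
    likewise t mu = v - A mu with mu = M v. The remainders each contain one factor M and are O(1 /
    t) by [resolvent_bound]. *)
Lemma resolvent_limit A M (v mu : 'cV[R]_n) t i j : i != j -> pos_def A -> 1 <= t ->
  (A + t%:M) *m M = 1%:M -> pos_def (A + t%:M) -> (A + t%:M) *m mu = v ->
  exists dM dmu dmu' : R,
   [/\ t ^+ 2 * M i j = - A i j + dM, t * mu i ord0 = v i ord0 + dmu,
       t * mu j ord0 = v j ord0 + dmu' &
    [/\ `|dM| <= (\sum_k `|(A *m A) i k|) / t,
        `|dmu| <= (\sum_k `|A i k| * \sum_l `|v l ord0|) / t &
        `|dmu'| <= (\sum_k `|A j k| * \sum_l `|v l ord0|) / t]].
Proof.
move=> ij pA t1 BM pB Bmu.
have t0 : 0 < t by apply: lt_le_trans t1.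
have Mb := resolvent_bound pA t0 BM pB.
have MB := mulmx1C BM.
have tM : t *: M = 1%:M - A *m M.
  by rewrite -BM mulmxDl mul_scalar_mx addrC addKr.
have ttM : (t ^+ 2) *: M = t%:M - A + A *m A *m M.
  rewrite expr2 -scalerA tM scalerBr scalemx1 -addrA; congr (_ + _).
  by rewrite scalemxAr tM mulmxBr mulmx1 opprB addrC mulmxA.
have tmu : t *: mu = v - A *m mu.
  by rewrite -Bmu mulmxDl mul_scalar_mx addrC addKr.
have muE : mu = M *m v by rewrite -Bmu mulmxA MB mul1mx.
have mub k : `|mu k ord0| <= (\sum_l `|v l ord0|) / t.
  rewrite muE mxE mulr_suml; apply: le_trans (ler_norm_sum _ _ _) _.
  apply: ler_sum => l _; rewrite normrM mulrC.
  by rewrite ler_wpM2l.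
have Amub k : `|- (A *m mu) k ord0| <= (\sum_l `|A k l| * \sum_l `|v l ord0|) / t.
  rewrite normrN mxE mulr_suml; apply: le_trans (ler_norm_sum _ _ _) _.
  by apply: ler_sum => l _; rewrite normrM -mulrA ler_wpM2l.
exists ((A *m A *m M) i j), (- (A *m mu) i ord0), (- (A *m mu) j ord0); split.
- have := congr1 (fun z : 'M[R]_n => z i j) ttM.
  rewrite [LHS]mxE [X in _ = X]mxE [X in _ = X + _]mxE [X in _ = X + _ + _]mxE (negbTE ij).
  by rewrite mulr0n add0r [X in _ = X + _]mxE.
- by have := congr1 (fun z : 'cV[R]_n => z i ord0) tmu; rewrite [LHS]mxE [X in _ = X]mxE [X in _ = _ + X]mxE.
- by have := congr1 (fun z : 'cV[R]_n => z j ord0) tmu; rewrite [LHS]mxE [X in _ = X]mxE [X in _ = _ + X]mxE.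
- split=> //; rewrite mxE mulr_suml; apply: le_trans (ler_norm_sum _ _ _) _.
  by apply: ler_sum => l _; rewrite normrM ler_wpM2l.
Qed.

(** The hypothesis is multiplied by t^2: M_ij absorbs both factors, each mean absorbs one. Explicit
    error constants take the place of limits. *)
Lemma resolvent_asymptotics A (v : 'cV[R]_n) i j : i != j -> pos_def A ->
  (forall t, 1 <= t -> exists M mu, [/\ (A + t%:M) *m M = 1%:M, (A + t%:M) *m mu = v &
     0 <= M i j + 2 * mu i ord0 * mu j ord0]) ->
  0 <= - A i j + 2 * v i ord0 * v j ord0.
Proof.
move=> ij pA H.
have pB t : 0 < t -> pos_def (A + t%:M).
  move=> t0; case: pA => sA pA; split; first by rewrite linearD /= sA tr_scalar_mx.
  move=> x x0; rewrite mulmxDr mulmxDl mxE mul_mx_scalar -scalemxAl ltr_wpDr ?pA//.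
  rewrite mxE mulr_ge0 ?(ltW t0)// mxE.
  by apply: sumr_ge0 => k _; rewrite mxE -expr2 sqr_ge0.
pose KM := \sum_k `|(A *m A) i k|.
pose Ki := \sum_k `|A i k| * \sum_l `|v l ord0|.
pose Kj := \sum_k `|A j k| * \sum_l `|v l ord0|.
(* [KM] bounds the error on the covariance; the other terms bound the errors in the product (v_i +
   di) (v_j + dj). *)
pose K := KM + 2 * (`|v i ord0| * Kj + Ki * `|v j ord0| + Ki * Kj).
have KM0 : 0 <= KM by apply: sumr_ge0.
have Ki0 : 0 <= Ki by apply: sumr_ge0 => k _; rewrite mulr_ge0// sumr_ge0.
have Kj0 : 0 <= Kj by apply: sumr_ge0 => k _; rewrite mulr_ge0// sumr_ge0.
have K0 : 0 <= K by rewrite /K !(addr_ge0, mulr_ge0).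
have key t : 1 <= t -> 0 <= - A i j + 2 * v i ord0 * v j ord0 + K / t.
  move=> t1; have t0 : 0 < t by apply: lt_le_trans t1.
  have pBt := pB t t0.
  have [M [mu [BM Bmu h]]] := H t t1.
  have [dM [di [dj [eM ei ej [bM bi bj]]]]] := resolvent_limit ij pA t1 BM pBt Bmu.
  have : 0 <= t ^+ 2 * (M i j + 2 * mu i ord0 * mu j ord0) by rewrite mulr_ge0// sqr_ge0.
  have -> : t ^+ 2 * (M i j + 2 * mu i ord0 * mu j ord0) =
     t ^+ 2 * M i j + 2 * (t * mu i ord0) * (t * mu j ord0) by ring.
  rewrite eM ei ej => /le_trans; apply.
  rewrite -subr_ge0.
  have -> : - A i j + 2 * v i ord0 * v j ord0 + K / t -
      (- A i j + dM + 2 * (v i ord0 + di) * (v j ord0 + dj)) =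
     (KM / t - dM) + 2 * ((`|v i ord0| * (Kj / t) - v i ord0 * dj) +
       (Ki / t * `|v j ord0| - di * v j ord0) + (Ki * Kj / t - di * dj)).
    by rewrite /K; field; rewrite gt_eqF.
  have nle (x y : R) : `|x| <= y -> 0 <= y - x.
    by move=> xy; rewrite subr_ge0 (le_trans (ler_norm x)).
  (* The product di dj is of order 1 / t^2; bounding one factor by a constant, by means of t >= 1,
     fits it into K / t. *)
  have bi' : `|di| <= Ki by apply: le_trans bi _; rewrite ler_pdivrMr// ler_peMr.
  apply: addr_ge0; first exact: nle.
  apply: mulr_ge0 => //; apply: addr_ge0; [apply: addr_ge0|]; apply: nle; rewrite normrM.
  - by rewrite ler_wpM2l.
  - by rewrite ler_wpM2r.
  - by rewrite -mulrA ler_pM.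
have : forall e, 0 < e -> - A i j + 2 * v i ord0 * v j ord0 >= - e.
  move=> e e0.
  pose t := 1 + K / e.
  have Ke : 0 <= K / e by rewrite divr_ge0// ltW.
  have t1 : 1 <= t by rewrite /t lerDl.
  have t0 : 0 < t by apply: lt_le_trans t1.
  have := key t t1; have : K / t <= e.
    rewrite ler_pdivrMr// /t mulrDr mulr1 mulrCA divff ?gt_eqF// mulr1.
    by rewrite lerDr ltW.
  lra.
move=> h; rewrite leNgt; apply/negP => neg.
have := h (- (- A i j + 2 * v i ord0 * v j ord0) / 2); lra.
Qed.

End M_matrix_inverse.

(** * The bound on the critical point, one pair of indices at a time *)

Theorem theorem1p8 (R : realType) (d : measure_display) (T : measurableType d)
  (P : probability T R) (n : nat) (G : 'I_n -> T -> R) (Gamma : 'M[R]_n)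
  (alpha0 : R) :
  centered_gaussian P G Gamma ->
  inf_divisible P (sq_rvec G) ->
  pos_def Gamma ->
  irreducible_mx Gamma ->
  M_matrix (invmx Gamma) ->
  (exists i j : 'I_n, row_sum_inv Gamma i * row_sum_inv Gamma j < 0) ->
  critical_point P G alpha0 ->
  forall i j : 'I_n, row_sum_inv Gamma i * row_sum_inv Gamma j < 0 ->
    alpha0 <= Num.sqrt (invmx Gamma i j /
                        (2 * row_sum_inv Gamma i * row_sum_inv Gamma j)).
Proof.
move=> gG _ pG irrG [uA _ offA] _ [a_gt0 idle _] i j DD.
set A := invmx Gamma in uA offA *.
have uG : Gamma \in unitmx by rewrite -unitmx_inv.
have AG : A *m Gamma = 1%:M by exact: mulVmx.
have pA : pos_def A by apply: pos_def_inverse pG _; exact: mulmxV.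
have ij : i != j.
  by apply: contraTneq DD => ->; rewrite -leNgt -expr2 sqr_ge0.
(* Divisibility holds at alpha0 itself, so the critical value can be tested directly, without
   approximation from below. *)
have idZ : inf_divisible P (shifted_sq G alpha0) by apply: idle; rewrite gtr0_norm.
have mG : rvec_measurable G by case: gG.
pose X k w := G k w + alpha0.
have mX k : measurable_fun setT (X k) by apply: measurable_funD => //; exact: mG.
have mZ : rvec_measurable (shifted_sq G alpha0) by move=> k; apply: (measurable_funX 2 (mX k)).
have Z0 k w : 0 <= shifted_sq G alpha0 k w by rewrite sqr_ge0.
(* The vector preserved by every reweighting; its entries are alpha0 D_k, which is how the row sums
   enter. *)
pose v : 'cV[R]_n := A *m const_mx alpha0.
have vE k : v k ord0 = alpha0 * row_sum_inv Gamma k.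
  by rewrite mxE /row_sum_inv mulr_sumr; apply: eq_bigr => l _; rewrite mxE mulrC.
have s0 : gaussian_state P X (fun=> 1) 1 Gamma (const_mx alpha0) A v.
  split=> //; first by move=> w; rewrite ler01 lexx.
  exact: gaussian_transform_base.
have : 0 <= - A i j + 2 * v i ord0 * v j ord0.
  apply: resolvent_asymptotics => // t t1.
  have t0 : 0 < t by apply: lt_le_trans t1.
  have [C [M [mu]]] := gaussian_state_seq mX (index_enum 'I_n) t0 s0.
  (* [index_enum] visits each coordinate once, so the rank one terms add up to the identity and the
     precision matrix becomes A + t. *)
  rewrite (_ : \sum_(k <- _) _ = 1%:M); last first.
    by rewrite mx1_sum_delta; apply: eq_bigr => k _; rewrite trmx_delta mul_delta_mx.
  rewrite scalemx1 => st; have [_ _ _ [_ pB BM Bmu]] := st.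
  exists M, mu; split=> //.
  have M0 : 0 < M i j by exact: (irreducible_inverse_gt0 pG irrG AG pA offA (ltW t0) BM pB).
  suff : 0 <= M i j ^+ 2 + 2 * M i j * mu i ord0 * mu j ord0.
    have -> : M i j ^+ 2 + 2 * M i j * mu i ord0 * mu j ord0 =
      M i j * (M i j + 2 * mu i ord0 * mu j ord0) by ring.
    by rewrite pmulr_rge0.
  apply: (four_point_gaussian mX st ij).
  have t_ge0 (k : 'I_n) : 0 <= (fun=> t) k by exact: ltW.
  have expoE l k w : expo l (shifted_sq G alpha0 k w) = sq_weight X l k w.
    by rewrite /expo max_l.
  pose Z := shifted_sq G alpha0.
  have WE w : \prod_k expo t (Z k w) = 1 * \prod_k sq_weight X t k w.
    by rewrite mul1r; apply: eq_bigr => k _; exact: expoE.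
  have E0 : laplace P Z (fun=> t) = \int[P]_w (1 * \prod_k sq_weight X t k w).
    by apply: eq_Rintegral => w _; exact: WE.
  have E1 k : laplace P Z (shift_at (fun=> t) k) =
      \int[P]_w (1 * \prod_k sq_weight X t k w * sq_weight X 1 k w).
    apply: eq_Rintegral => w _.
    by rewrite (prod_expo_shift (fun=> t) k (Z^~ w)) WE expoE.
  have E2 : laplace P Z (shift_at (shift_at (fun=> t) i) j) =
      \int[P]_w (1 * \prod_k sq_weight X t k w * sq_weight X 1 i w * sq_weight X 1 j w).
    apply: eq_Rintegral => w _.
    rewrite (prod_expo_shift (shift_at (fun=> t) i) j (Z^~ w)).
    by rewrite (prod_expo_shift (fun=> t) i (Z^~ w)) WE !expoE.
  have := inf_divisible_laplace mZ Z0 i j idZ t_ge0.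
  by rewrite -/Z E0 !E1 E2.
rewrite !vE => h.
set Di := row_sum_inv Gamma i in DD h *; set Dj := row_sum_inv Gamma j in DD h *.
have DD2 : 2 * Di * Dj < 0 by rewrite -mulrA pmulr_rlt0.
have a2 : alpha0 ^+ 2 <= A i j / (2 * Di * Dj).
  by rewrite ler_ndivlMr//; lra.
(* [Num.sqrt] is 0 on negative arguments, so the sign of the radicand is needed before squaring; it
   dominates a square. *)
have q0 : 0 <= A i j / (2 * Di * Dj) by apply: le_trans a2; rewrite sqr_ge0.
by rewrite -(@ler_pXn2r R 2 isT) ?nnegrE ?sqrtr_ge0 ?(ltW a_gt0)// sqr_sqrtr.
Qed.
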